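(* Consider the following uplink system. A base station (BS) with $M$ antennas serves $K$ single-antenna user equipments (UEs) at SNR $\rho>0$. The channel matrix is $H=[h_1,\ldots,h_K]\in\mathbb{C}^{M\times K}$, where $h_1,\ldots,h_K$ are independent and $h_k\sim\mathcal{CN}(0_M,C_{h_k})$ with Hermitian positive semidefinite covariance $C_{h_k}\in\mathbb{C}^{M\times M}$. Let $h=\mathrm{vec}(H)$ and $C_h=\mathrm{blkdiag}(C_{h_1},\ldots,C_{h_K})$. Define the 1-bit quantizer, applied entrywise to a complex array $X$, by $$Q(X)=\sqrt{\tfrac{\rho K+1}{2}}\big(\mathrm{sgn}(\Re[X])+j\,\mathrm{sgn}(\Im[X])\big).$$ Channel estimation: let $P=[p_1,\ldots,p_K]\in\mathbb{C}^{\tau\times K}$, $\tau\ge K$, be a pilot matrix with mutually orthogonal columns and entries $P_{u,k}$ satisfying $|P_{u,k}|=1$ for all $u,k$. The BS receives $Y_p=\sqrt{\rho}\,HP^{\mathrm H}+Z_p\in\mathbb{C}^{M\times\tau}$, with $Z_p$ having i.i.d. $\mathcal{CN}(0,1)$ entries, and with $\bar P=P\otimes I_M$ we have $y_p=\mathrm{vec}(Y_p)=\sqrt{\rho}\,\bar P^{*}h+z_p$, $z_p=\mathrm{vec}(Z_p)$. It observes $r_p=Q(y_p)\in\mathbb{C}^{M\tau}$. Let $C_{y_p}=\rho\bar P^{*}C_h\bar P^{\mathrm T}+I_{M\tau}$, $A_p=\sqrt{\tfrac{2}{\pi}(\rho K+1)}\,\mathrm{diag}(C_{y_p})^{-1/2}$,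 $C_{r_p}=\mathbb{E}[r_pr_p^{\mathrm H}]$ (assumed invertible), $\bar P_k=p_k\otimes I_M$, and define the Bussgang LMMSE channel estimate of UE $k$ as $\hat h_k=\sqrt{\rho}\,C_{h_k}\bar P_k^{\mathrm T}A_pC_{r_p}^{-1}r_p\in\mathbb{C}^M$. Data transmission: for a fixed (deterministic) data symbol vector $x=[x_1,\ldots,x_K]^{\mathrm T}\in\mathbb{C}^K$, the BS receives $y=\sqrt{\rho}\,Hx+z$ with $z\sim\mathcal{CN}(0_M,I_M)$, and observes $r=Q(y)$. Here $H$, $z$, $z_p$ are mutually independent. The MRC soft-estimated symbol of UE $k$ is $\hat x_k^{(\mathrm{MRC})}=\hat h_k^{\mathrm H}r$. Define $\Omega(t)=\frac{2}{\pi}\arcsin(t)$ and, for $m,n\in\{1,\ldots,M\}$, $u,v\in\{1,\ldots,\tau\}$, $$\alpha_m=\Big[\rho\sum_{k=1}^K C_{h_k}+I_M\Big]_{m,m},\quad \beta_m=\Big[\rho\sum_{k=1}^K C_{h_k}|x_k|^2+I_M\Big]_{m,m},$$ $$\zeta_{m,n,u,v}=\frac{\rho}{\sqrt{\alpha_m\alpha_n}}\Big[\sum_{k=1}^K C_{h_k}^{\mathrm T}P_{u,k}P_{v,k}^{*}\Big]_{m,n},\qquad \eta_{m,n,u}=\frac{\rho}{\sqrt{\alpha_n\beta_m}}\Big[\sum_{k=1}^K C_{h_k}x_kP_{u,k}\Big]_{m,n}.$$ Then the expected value $\mathsf{E}_k^{(\mathrm{MRC})}=\mathbb{E}_{H,z,z_p}[\hat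 x_k^{(\mathrm{MRC})}]$ is $$\mathsf{E}_k^{(\mathrm{MRC})}=\sqrt{\rho}\,\mathrm{tr}\big(C_{r_p}^{-1}A_p\bar P_k^{*}C_{h_k}C_{rr_p}\big),$$ where $C_{rr_p}=\mathbb{E}[r\,r_p^{\mathrm H}]\in\mathbb{C}^{M\times M\tau}$, and $$[C_{r_p}]_{(u-1)M+m,(v-1)M+n}=\begin{cases}\rho K+1,& m=n\text{ and }u=v,\\ (\rho K+1)\big(\Omega(\Re[\zeta_{m,n,u,v}])-j\,\Omega(\Im[\zeta_{m,n,u,v}])\big),&\text{otherwise},\end{cases}$$ $$[C_{rr_p}]_{m,(u-1)M+n}=(\rho K+1)\big(\Omega(\Re[\eta_{m,n,u}])+j\,\Omega(\Im[\eta_{m,n,u}])\big).$$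
   Context: $\mathrm{vec}$ stacks columns, so entry $(u-1)M+m$ of $y_p$ (or $r_p$) corresponds to antenna $m$ and pilot time $u$. $(\cdot)^{\mathrm T},(\cdot)^{\mathrm H},(\cdot)^*$ denote transpose, conjugate transpose, conjugate; $\otimes$ is the Kronecker product; $\mathrm{diag}(C)$ is the diagonal matrix with the diagonal entries of $C$; $\mathrm{sgn}$ is the sign function applied entrywise. $\mathcal{CN}(0,\Sigma)$ denotes a circularly-symmetric complex Gaussian distribution. *)

(* Defs.v *)
From HB Require Import structures.
From mathcomp Require Import all_boot all_algebra.
From mathcomp Require Import boolp classical_sets reals Rstruct Rstruct_topology ereal measure.
From mathcomp Require Import lebesgue_measure lebesgue_integral probability sequences exp trigo.
From mathcomp.real_closed Require Import complex.

Set Implicit Arguments.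
Unset Strict Implicit.
Unset Printing Implicit Defensive.
Import GRing.Theory Num.Theory.
Local Open Scope ring_scope.

Notation R := Rdefinitions.R.
Notation C := (Rdefinitions.R[i]).

Definition conjm (m n : nat) (A : 'M[C]_(m, n)) : 'M[C]_(m, n) :=
  map_mx (@conjc _) A.
Definition ctr (m n : nat) (A : 'M[C]_(m, n)) : 'M[C]_(n, m) := (conjm A)^T.

(* decoding of the flat index used by mathcomp's mxvec_index:
   unvec (mxvec_index a b) = (a, b) *)
Definition unvec (a b : nat) (i : 'I_(a * b)) : 'I_a * 'I_b :=
  enum_val (cast_ord (esym (mxvec_cast a b)) i).

(* column stacking vec: for Y : M x tau, entry mxvec_index u m of vec Y
   is Y m u  (antenna m, pilot time u), i.e. the paper's entry (u-1)M+m *)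
Definition vecm (m n : nat) (Y : 'M[C]_(m, n)) : 'cV[C]_(n * m) :=
  \col_i Y (unvec i).2 (unvec i).1.

Definition kron (m1 n1 m2 n2 : nat) (A : 'M[C]_(m1, n1)) (B : 'M[C]_(m2, n2))
  : 'M[C]_(m1 * m2, n1 * n2) :=
  \matrix_(i, j) (A (unvec i).1 (unvec j).1 * B (unvec i).2 (unvec j).2).

Definition blkdiag (K M : nat) (Ch : 'I_K -> 'M[C]_M) : 'M[C]_(K * M) :=
  \matrix_(i, j) (if (unvec i).1 == (unvec j).1
                  then Ch (unvec i).1 (unvec i).2 (unvec j).2 else 0).

Definition herm_psd (M : nat) (A : 'M[C]_M) : Prop :=
  ctr A = A /\ forall v : 'cV[C]_M, 0 <= complex.Re ((ctr v *m A *m v) 0 0).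

Definition quant (rho : R) (K : nat) (c : C) : C :=
  (Num.sqrt ((rho * K%:R + 1) / 2))%:C%C *
  ((Num.sg (complex.Re c))%:C%C + 'i%C * (Num.sg (complex.Im c))%:C%C).

Definition Omega (t : R) : R := 2 / pi * asin t.

Definition cexpect d (T : measurableType d) (Pr : probability T R)
  (f : T -> C) : C :=
  (Rintegral Pr setT (fun w => complex.Re (f w)))%:C%C
  + 'i%C * (Rintegral Pr setT (fun w => complex.Im (f w)))%:C%C.

Definition cexpect_mx d (T : measurableType d) (Pr : probability T R)
  (m n : nat) (F : T -> 'M[C]_(m, n)) : 'M[C]_(m, n) :=
  \matrix_(i, j) cexpect Pr (fun w => F w i j).

(* X ~ CN(0, S): X is a (measurable) random vector whose characteristic
   function is that of a circularly-symmetric complex Gaussian: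
   E[exp(j Re(v^H X))] = exp(- v^H S v / 4) for every v in C^n. *)
Definition is_CN d (T : measurableType d) (Pr : probability T R)
  (n : nat) (X : T -> 'cV[C]_n) (S : 'M[C]_n) : Prop :=
  (forall i,
     measurable_fun setT ((fun w => complex.Re (X w i 0)) : T -> (R : realType)) /\
     measurable_fun setT ((fun w => complex.Im (X w i 0)) : T -> (R : realType))) /\
  forall v : 'cV[C]_n,
    Rintegral Pr setT (fun w => cos (complex.Re ((ctr v *m X w) 0 0)))
      = expR (- complex.Re ((ctr v *m S *m v) 0 0) / 4) /\
    Rintegral Pr setT (fun w => sin (complex.Re ((ctr v *m X w) 0 0))) = 0.

(* Main.v *)
(* The only probabilistic input is the arcsine law E[sg X sg Y] = 2/pi asin(c / sqrt(ab))
   for a centred Gaussian pair, which has to be read off the characteristic function.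
   Writing sg x = 2/pi int_0^oo sin(s x)/s ds turns the left side into
   (2/pi)^2 int int E[sin(sX) sin(tY)] / (st) ds dt, where the expectation equals
   exp(-(a s^2 + b t^2)/2) sinh(c s t); since sinh(c s t)/(s t) is the integral of
   cosh(th s t) over th in [0, c], Tonelli and two Gaussian integrals leave
   int_0^c (ab - th^2)^(-1/2) dth.
   Real and imaginary parts of all received samples are Re(p^H W) for one complex
   Gaussian vector W, so every entry of both covariance matrices is an instance of the
   law; the receiver noise makes |c| < sqrt(ab) strictly for distinct samples, and on
   the diagonal one needs P(X = 0) = 0 instead.  The formula for the mean is linearity
   of the expectation, as C_rp and A_p are Hermitian. *)
Require Import Defs.
From HB Require Import structures.
From mathcomp Require Import all_boot all_order all_algebra.
From mathcomp Require Import boolp classical_sets functions reals Rstruct Rstruct_topology.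
From mathcomp Require Import ereal topology normedtype derive realfun measure numfun.
From mathcomp Require Import measurable_realfun lebesgue_measure lebesgue_integral.
From mathcomp Require Import probability sequences exp trigo ftc.
From mathcomp Require Import ring lra.
From mathcomp.real_closed Require Import complex.
Set Implicit Arguments.
Unset Strict Implicit.
Unset Printing Implicit Defensive.
Import Order.TTheory GRing.Theory Num.Theory.
Import numFieldNormedType.Exports.
Local Open Scope classical_set_scope.
Local Open Scope ring_scope.

(** * Integrals over the half-line *)

(** Only the characteristic function of the Gaussian vector is given, so there is no density to
    integrate against and every expectation is reached through sines and cosines. The sine integral
    of the sign converges only conditionally. Positivity takes the place of absolute convergence:
    when the covariance is nonnegative all sine transforms are nonnegative, and Tonelli justifies
    each exchange of two improper integrals. A negative covariance is reduced to this case by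
    reflecting one variable. For want of a density, P(X = 0) = 0 also needs an estimate of its own.
    Multiplying p by i turns imaginary parts into real parts. Circular symmetry then makes the four
    real sign correlations of two samples agree in pairs up to sign, and the resulting factor 2
    cancels the 1/2 in the squared amplitude of the quantiser. *)

Section half_line.
Context {rT : realType}.
Notation mu := (@lebesgue_measure rT).
Notation pos := (`]0%R, +oo[%classic : set rT).

Lemma norm_sin_le1 (t : rT) : `|sin t| <= 1.
Proof. by rewrite ler_norml sin_geN1 sin_le1. Qed.

Lemma norm_cos_le1 (t : rT) : `|cos t| <= 1.
Proof. by rewrite ler_norml cos_geN1 cos_le1. Qed.

Lemma is_derive_expRN (l t : rT) :
  is_derive t 1 (fun t : rT => expR (- (l * t))) (- l * expR (- (l * t))).
Proof.
have h : is_derive t 1 (fun t : rT => - (l * t)) (- l).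
  by apply: is_derive_eq; rewrite /GRing.scale/= mulr1 ?mulr0 ?addr0.
have := @is_derive1_comp _ (@expR rT) (fun t : rT => - (l * t)) t _ _ _ h.
move/(_ _ (is_derive_expR _)) => H.
by apply: (is_derive_eq H); rewrite mulrC.
Qed.

Lemma is_derive_sinM (x t : rT) :
  is_derive t 1 (fun t : rT => sin (t * x)) (x * cos (t * x)).
Proof.
have h : is_derive t 1 (fun t : rT => t * x) x.
  by apply: is_derive_eq; rewrite /GRing.scale/= mulr1 ?mulr0 ?add0r.
have H := @is_derive1_comp _ (@sin rT) (fun t : rT => t * x) t _ _ (is_derive_sin _) h.
by apply: (is_derive_eq H); rewrite mulrC.
Qed.

Lemma is_derive_cosM (x t : rT) :
  is_derive t 1 (fun t : rT => cos (t * x)) (- x * sin (t * x)).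
Proof.
have h : is_derive t 1 (fun t : rT => t * x) x.
  by apply: is_derive_eq; rewrite /GRing.scale/= mulr1 ?mulr0 ?add0r.
have H := @is_derive1_comp _ (@cos rT) (fun t : rT => t * x) t _ _ (is_derive_cos _) h.
by apply: (is_derive_eq H); rewrite mulrC !mulNr mulrN.
Qed.

Lemma ge0_is_derive_integral_pos (f F : rT -> rT) (l : rT) :
  (forall x, 0 <= x -> 0 <= f x) -> continuous f ->
  (forall x : rT, is_derive x 1 F (f x)) -> F x @[x --> +oo] --> l ->
  (\int[mu]_(x in pos) (f x)%:E = (l - F 0)%:E)%E.
Proof.
move=> f0 cf dF Fl.
rewrite integral_itv_obnd_cbnd; last first.
  by apply/measurable_EFinP; apply: measurable_funTS; exact: continuous_measurable_fun.
rewrite (@ge0_continuous_FTC2y _ f F 0 l) ?EFinB//.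
- exact: continuous_subspaceT.
- apply: cvg_at_right_filter; apply: differentiable_continuous.
  by apply/derivable1_diffP; have [] := dF 0.
- by move=> x _; rewrite derive1E; have [_ ->] := dF x.
Qed.

Lemma adde_EFinI (r v : rT) (e : \bar rT) : (r%:E + e = r%:E + v%:E)%E -> e = v%:E.
Proof. by case: e => [u| |] //= [/addrI ->]. Qed.

Lemma cvgy_expRN (l : rT) : 0 < l -> expR (- (l * t)) @[t --> +oo] --> (0 : rT).
Proof.
move=> l0; apply: (@cvg_comp _ _ _ (fun t => l * t) (fun z => expR (- z)) _ (pinfty_nbhs rT)).
  exact: gt0_cvgMry.
exact: cvgr_expR.
Qed.

(** The constant [c] dominates the oscillating terms, so the integrand is nonnegative and a
    primitive with a limit at infinity suffices. The Laplace transforms of sine and cosine follow by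
    subtracting the contribution of [c]. *)
Lemma integral_expR_trig (l x c a b : rT) : 0 < l -> `|a| + `|b| <= c ->
  (\int[mu]_(t in pos) (expR (- (l * t)) * (c + a * sin (t * x) + b * cos (t * x)))%:E
   = (c / l + (x * a + l * b) / (l ^+ 2 + x ^+ 2))%:E)%E.
Proof.
move=> l0 abc.
have lx0 : l ^+ 2 + x ^+ 2 != 0.
  by rewrite gt_eqF// ltr_wpDr ?sqr_ge0// exprn_gt0.
(* [A] and [B] solve the linear system - l A - x B = a, x A - l B = b, obtained by matching the
   derivative of [F] with the integrand. *)
pose A := (x * b - l * a) / (l ^+ 2 + x ^+ 2).
pose B := - (x * a + l * b) / (l ^+ 2 + x ^+ 2).
pose F t := expR (- (l * t)) * (- (c / l) + A * sin (t * x) + B * cos (t * x)).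
have sin1 := norm_sin_le1; have cos1 := norm_cos_le1.
transitivity ((0 - F 0)%:E); last first.
  congr (_%:E); rewrite /F !(mul0r, mulr0) oppr0 expR0 sin0 cos0 /B; field.
  by rewrite lx0 gt_eqF.
apply: (@ge0_is_derive_integral_pos _ F 0).
- move=> t t0; rewrite mulr_ge0 ?expR_ge0//.
  have : `|a * sin (t * x)| <= `|a| by rewrite normrM ler_piMr.
  have : `|b * cos (t * x)| <= `|b| by rewrite normrM ler_piMr.
  rewrite !ler_norml => /andP[? _] /andP[? _]; lra.
- move=> t; apply: differentiable_continuous; apply/derivable1_diffP.
  have := is_derive_expRN l t; have := is_derive_sinM x t.
  have := is_derive_cosM x t => d1 d2 d3.
  by apply: ex_derive.
- move=> t.
  have := is_derive_expRN l t; have := is_derive_sinM x t.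
  have := is_derive_cosM x t => d1 d2 d3.
  rewrite /F; apply: is_derive_eq.
  rewrite /GRing.scale/= /A /B; field.
  by rewrite lx0 gt_eqF.
- pose k := `|c / l| + `|A| + `|B|.
  have cvk : k * expR (- (l * t)) @[t --> +oo] --> (0 : rT).
    by rewrite -(mulr0 k); apply: cvgMl_tmp; exact: cvgy_expRN.
  apply: (@squeeze_cvgr _ _ _ _ (fun t => - (k * expR (- (l * t))))
     (fun t => k * expR (- (l * t)))) => //; last first.
    by rewrite -oppr0; exact: cvgN.
  near=> t; rewrite -ler_norml /F normrM (ger0_norm (expR_ge0 _)) mulrC.
  rewrite ler_wpM2r ?expR_ge0// /k.
  rewrite (le_trans (ler_normD _ _))// lerD//.
    rewrite (le_trans (ler_normD _ _))// normrN lerD// normrM ler_piMr//.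
  by rewrite normrM ler_piMr.
Unshelve. all: by end_near. Qed.

Lemma integral_expRN (l : rT) : 0 < l ->
  (\int[mu]_(t in pos) (expR (- (l * t)))%:E = l^-1%:E)%E.
Proof.
move=> l0; have := @integral_expR_trig l 0 1 0 0 l0.
rewrite !normr0 addr0 ler01 => /(_ isT).
rewrite !(mulr0, mul0r, addr0, div1r) => <-.
by apply: eq_integral => t _; rewrite !(mul0r, addr0, mulr1).
Qed.

Lemma measurable_expRN (l : rT) : measurable_fun setT (fun t : rT => expR (- (l * t))).
Proof. by do ! apply: measurableT_comp => //. Qed.

Lemma integrable_expRN (l : rT) : 0 < l ->
  mu.-integrable pos (EFin \o (fun t => expR (- (l * t)))).
Proof.
move=> l0; apply/integrableP; split.
  by apply/measurable_EFinP; apply: measurable_funTS; apply: measurable_expRN.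
under eq_integral do rewrite /= ger0_norm ?expR_ge0//.
by rewrite integral_expRN// ltry.
Qed.

Lemma measurable_sin : measurable_fun setT (@sin rT).
Proof. by apply: continuous_measurable_fun; exact: continuous_sin. Qed.

Lemma measurable_cos : measurable_fun setT (@cos rT).
Proof. by apply: continuous_measurable_fun; exact: continuous_cos. Qed.

Lemma integrable_expRNM (l : rT) (h : rT -> rT) : 0 < l -> measurable_fun setT h ->
  (forall t, `|h t| <= 1) ->
  mu.-integrable pos (EFin \o (fun t => expR (- (l * t)) * h t)).
Proof.
move=> l0 mh h1; apply: (le_integrable _ _ _ (integrable_expRN l0)) => //.
  apply/measurable_EFinP; apply: measurable_funTS; apply: measurable_funM => //.
  exact: measurable_expRN.
move=> t _ /=; rewrite lee_fin normrM ler_piMr//.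
Qed.

Lemma laplace_sin (l x : rT) : 0 < l ->
  (\int[mu]_(t in pos) (expR (- (l * t)) * sin (t * x))%:E = (x / (l ^+ 2 + x ^+ 2))%:E)%E.
Proof.
move=> l0; have := @integral_expR_trig l x 1 1 0 l0.
rewrite normr1 normr0 addr0 lexx => /(_ isT).
rewrite !(mul1r, mulr0, addr0, mulr1).
under eq_integral do rewrite mul0r addr0 mul1r mulrDr mulr1 EFinD.
rewrite integralD//=.
- by rewrite integral_expRN// EFinD => /adde_EFinI.
- exact: integrable_expRN.
- apply: integrable_expRNM => //; last first.
    by move=> t; exact: norm_sin_le1.
  by apply: measurableT_comp; [exact: measurable_sin|exact: measurable_funM].
Qed.

Lemma laplace_cos (l x : rT) : 0 < l ->
  (\int[mu]_(t in pos) (expR (- (l * t)) * cos (t * x))%:E = (l / (l ^+ 2 + x ^+ 2))%:E)%E.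
Proof.
move=> l0; have := @integral_expR_trig l x 1 0 1 l0.
rewrite normr1 normr0 add0r lexx => /(_ isT).
rewrite !(mul1r, mulr0, add0r, mulr1).
under eq_integral do rewrite mul0r addr0 mul1r mulrDr mulr1 EFinD.
rewrite integralD//=.
- by rewrite integral_expRN// EFinD => /adde_EFinI.
- exact: integrable_expRN.
- apply: integrable_expRNM => //; last first.
    by move=> t; exact: norm_cos_le1.
  by apply: measurableT_comp; [exact: measurable_cos|exact: measurable_funM].
Qed.

Lemma gt0_integral_cauchy (x : rT) : 0 < x ->
  (\int[mu]_(l in pos) (x / (l ^+ 2 + x ^+ 2))%:E = (pi / 2)%:E)%E.
Proof.
move=> x0.
have lx0 l : l ^+ 2 + x ^+ 2 != 0.
  by rewrite gt_eqF// ltr_wpDl ?sqr_ge0// exprn_gt0.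
transitivity ((pi / 2 - atan (0 / x))%:E); last by rewrite mul0r atan0 subr0.
apply: (@ge0_is_derive_integral_pos _ (fun l => atan (l / x)) (pi / 2)).
- by move=> l _; rewrite divr_ge0 ?addr_ge0 ?sqr_ge0// ltW.
- move=> l; apply: cvgM; first exact: cvg_cst.
  apply: cvgV => //; apply: cvgD; last exact: cvg_cst.
  exact: exprn_continuous.
- move=> l.
  have h : is_derive l 1 (fun t : rT => t / x) x^-1.
    by apply: is_derive_eq; rewrite /GRing.scale/= mulr1 ?mulr0 ?add0r.
  have H := @is_derive1_comp _ (@atan rT) (fun t : rT => t / x) l _ _ (is_derive1_atan _) h.
  apply: (is_derive_eq H); field.
  by rewrite lx0 gt_eqF.
- apply: (@cvg_comp _ _ _ (fun l => l / x) (@atan rT) _ (pinfty_nbhs rT)).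
    by apply: gt0_cvgMly => //; rewrite invr_gt0.
  exact: cvgy_atan.
Qed.

(** The sign enters here. Since x / (l^2 + x^2) is the Laplace transform of sin(t x), this is the
    Dirichlet integral of sin(t x) / t with the two integrations in the order that converges
    absolutely. *)
Lemma integral_cauchy (x : rT) :
  (\int[mu]_(l in pos) (x / (l ^+ 2 + x ^+ 2))%:E = (pi / 2 * Num.sg x)%:E)%E.
Proof.
have [x0|x0|->] := ltgtP x 0; last first.
- by under eq_integral do rewrite mul0r; rewrite integral0 sgr0 mulr0.
- by rewrite gt0_integral_cauchy// gtr0_sg// mulr1.
- rewrite ltr0_sg// mulrN1 EFinN -(@gt0_integral_cauchy (- x)) ?oppr_gt0//.
  rewrite -integral_ge0N//.
    by apply: eq_integral => l _; rewrite sqrrN mulNr EFinN oppeK.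
  move=> l _; rewrite lee_fin divr_ge0 ?addr_ge0 ?sqr_ge0//.
  by rewrite oppr_ge0 ltW.
Qed.

End half_line.

(** * Exchanging integrals over products of domains *)

Section iterated.
Local Open Scope ereal_scope.
Context d1 d2 (T1 : measurableType d1) (T2 : measurableType d2) (rT : realType).
Variables (m1 : {sigma_finite_measure set T1 -> \bar rT}).
Variables (m2 : {sigma_finite_measure set T2 -> \bar rT}).
Implicit Types (f : T1 -> T2 -> rT).

(** Moves both domains into the integrand as indicators, so that Fubini and Tonelli on the whole
    product apply. *)
Lemma iterated_integral_indic (D1 : set T1) (D2 : set T2) f :
  \int[m1]_(x in D1) \int[m2]_(y in D2) (f x y)%:E =
  \int[m1]_x \int[m2]_y (f x y * (\1_D1 x * \1_D2 y))%:E.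
Proof.
rewrite integral_mkcond; apply: eq_integral => x _; rewrite patchE indicE.
case: ifPn => xD; last first.
  by under eq_integral do rewrite mul0r mulr0; rewrite integral0.
rewrite integral_mkcond; apply: eq_integral => y _; rewrite patchE indicE mul1r.
by case: ifPn; rewrite ?mulr1// mulr0.
Qed.

Let measurable_restr f (D1 : set T1) (D2 : set T2) :
  measurable D1 -> measurable D2 ->
  measurable_fun setT (fun z => f z.1 z.2) ->
  measurable_fun setT (fun z => (f z.1 z.2 * (\1_D1 z.1 * \1_D2 z.2))%:E).
Proof.
move=> mD1 mD2 mf; apply/measurable_EFinP/measurable_funM => //.
by apply: measurable_funM; apply: (measurableT_comp (measurable_indic _)).
Qed.

Lemma tonelli_in f (D1 : set T1) (D2 : set T2) :
  measurable D1 -> measurable D2 ->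
  measurable_fun setT (fun z => f z.1 z.2) ->
  (forall x y, D1 x -> D2 y -> (0 <= f x y)%R) ->
  \int[m1]_(x in D1) \int[m2]_(y in D2) (f x y)%:E =
  \int[m2]_(y in D2) \int[m1]_(x in D1) (f x y)%:E.
Proof.
move=> mD1 mD2 mf f0.
rewrite (iterated_integral_indic D1 D2 f).
rewrite (@fubini_tonelli _ _ _ _ _ m1 m2
  (fun z => (f z.1 z.2 * (\1_D1 z.1 * \1_D2 z.2))%:E)); last 2 first.
- exact: measurable_restr.
- move=> [x y] /=; rewrite lee_fin !indicE.
  have [xD|_] := boolP (x \in D1); last by rewrite mul0r mulr0.
  have [yD|_] := boolP (y \in D2); last by rewrite !mulr0.
  by rewrite !mulr1; apply: f0; rewrite -in_setE.
rewrite [RHS]integral_mkcond; apply: eq_integral => y _; rewrite patchE /= indicE.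
case: ifPn => yD; last first.
  by under eq_integral do rewrite !mulr0; rewrite integral0.
rewrite [RHS]integral_mkcond; apply: eq_integral => x _; rewrite patchE indicE mulr1.
by case: ifPn; rewrite ?mulr1// mulr0.
Qed.

Lemma fubini_in f (D1 : set T1) (D2 : set T2) :
  measurable D1 -> measurable D2 ->
  measurable_fun setT (fun z => f z.1 z.2) ->
  \int[m1]_(x in D1) \int[m2]_(y in D2) `|f x y|%:E < +oo ->
  \int[m1]_(x in D1) \int[m2]_(y in D2) (f x y)%:E =
  \int[m2]_(y in D2) \int[m1]_(x in D1) (f x y)%:E.
Proof.
move=> mD1 mD2 mf foo.
rewrite (iterated_integral_indic D1 D2 f).
rewrite (@Fubini _ _ _ _ _ m1 m2
  (fun z => (f z.1 z.2 * (\1_D1 z.1 * \1_D2 z.2))%:E)); last first.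
  apply/integrable12ltyP; first exact: measurable_restr.
  move: foo; rewrite (iterated_integral_indic D1 D2 (fun x y => `|f x y|%R)).
  congr (_ < _); apply: eq_integral => x _; apply: eq_integral => y _ /=.
  congr (_%:E); rewrite normrM; congr (_ * _)%R.
  by rewrite ger0_norm// mulr_ge0// indicE.
rewrite [RHS]integral_mkcond; apply: eq_integral => y _; rewrite patchE /= indicE.
case: ifPn => yD; last first.
  by under eq_integral do rewrite !mulr0; rewrite integral0.
rewrite [RHS]integral_mkcond; apply: eq_integral => x _; rewrite patchE indicE mulr1.
by case: ifPn; rewrite ?mulr1// mulr0.
Qed.

End iterated.

Section measurability.
Context d (T : measurableType d) (rT : realType).

(** On nonnegative reals, 0 included, the inverse is the power with exponent -1, which is
    measurable. *)
Lemma measurable_fun_ge0V (f : T -> rT) : (forall x, 0 <= f x) ->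
  measurable_fun setT f -> measurable_fun setT (fun x => (f x)^-1).
Proof.
move=> f0 mf; rewrite (_ : (fun _ => _) = (fun x => f x `^ (-1))); last first.
  by apply/funext => x; rewrite powR_inv1.
by apply: (@measurableT_comp _ _ _ _ _ _ (fun y => y `^ (-1)) _ f) => //; exact: measurable_powR.
Qed.

Lemma measurable_sgr : measurable_fun setT (@Num.sg rT).
Proof.
rewrite (_ : Num.sg = (fun x => if x == 0 then 0 else if x < 0 then -1 else 1))//.
apply: measurable_fun_ifT => //; first exact: measurable_fun_eqr.
by apply: measurable_fun_ifT => //; exact: measurable_fun_ltr.
Qed.

End measurability.

(** * Sign correlations of a Gaussian pair *)

Section sign_expectation.
Context d (T : measurableType d) (rT : realType) (P : probability T rT).
Notation mu := (@lebesgue_measure rT).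
Notation pos := (`]0%R, +oo[%classic : set rT).
Implicit Types X Z : T -> rT.

(** A bound on the t-integral of |k| that is uniform in [w], times a bound on [Z], gives absolute
    integrability because the outer measure is a probability. It serves the Cauchy kernel and both
    Laplace kernels. *)
Lemma expect_integral_swap (k : T -> rT -> rT) (K Z : T -> rT) (B C : rT) :
  measurable_fun setT (fun z => k z.1 z.2) -> measurable_fun setT Z ->
  (forall w, `|Z w| <= B) ->
  (forall w, (\int[mu]_(t in pos) `|k w t|%:E <= C%:E)%E) ->
  (forall w, (\int[mu]_(t in pos) (k w t)%:E = (K w)%:E)%E) ->
  (\int[P]_w (K w * Z w)%:E = \int[mu]_(t in pos) \int[P]_w (k w t * Z w)%:E)%E.
Proof.
move=> mk mZ ZB kC kK.
have mkw w : measurable_fun setT (k w) by exact: (measurable_fun_pair2 w mk).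
have ik w : mu.-integrable pos (EFin \o k w).
  apply/integrableP; split.
    by apply/measurable_EFinP; exact: measurable_funTS (mkw w).
  by apply: le_lt_trans (kC w) _; rewrite ltry.
transitivity (\int[P]_w \int[mu]_(t in pos) (k w t * Z w)%:E)%E.
  apply: eq_integral => w _.
  under [RHS]eq_integral do rewrite EFinM.
  rewrite (@integralZr _ _ _ mu pos _ _ (ik w))//= kK EFinM//.
rewrite (@fubini_in _ _ _ _ _ P mu (fun w t => k w t * Z w))//.
  apply: measurable_funM => //; exact: (measurableT_comp mZ).
apply: (@le_lt_trans _ _ (\int[P]_w (C * B)%:E)%E); last first.
  by rewrite integral_cst//= probability_setT mule1 ltry.
apply: ge0_le_integral => //.
- by move=> w _; apply: integral_ge0.
- under eq_fun do rewrite integral_mkcond.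
  apply: (@measurable_fun_fubini_tonelli_F _ _ _ _ _ mu
    (fun z => ((fun t => `|k z.1 t * Z z.1|%:E) \_ pos) z.2)).
    rewrite (_ : (fun z => _) = (fun z => (`|k z.1 z.2 * Z z.1| * \1_pos z.2)%:E)).
      apply/measurable_EFinP; apply: measurable_funM; last first.
        exact: (measurableT_comp (measurable_indic _)).
      apply: measurableT_comp => //; apply: measurable_funM => //.
      exact: (measurableT_comp mZ).
    apply/funext => z; rewrite patchE indicE.
    by case: ifPn; rewrite ?mulr1// mulr0.
  by move=> z; rewrite patchE; case: ifPn => // _; rewrite lee_fin.
- move=> w _.
  apply: (@le_trans _ _ (\int[mu]_(t in pos) (`|k w t|%:E * B%:E))%E).
    apply: ge0_le_integral => //.
    + apply/measurable_EFinP; apply: measurable_funTS.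
      apply: measurableT_comp => //; apply: measurable_funM => //; exact: mkw.
    + apply/measurable_EFinP; apply: measurable_funTS.
      by apply: measurable_funM => //; apply: (measurableT_comp _ (mkw w)).
    + by move=> t _; rewrite lee_fin normrM ler_wpM2l.
  have B0 : 0 <= B by rewrite (le_trans (normr_ge0 _) (ZB w)).
  rewrite ge0_integralZr//; last first.
    apply/measurable_EFinP; apply: measurable_funTS.
    exact: (measurableT_comp _ (mkw w)).
  by rewrite EFinM lee_wpmul2r.
Qed.

Lemma integral_norm_cauchy (x : rT) :
  (\int[mu]_(l in pos) `|x / (l ^+ 2 + x ^+ 2)|%:E <= (pi / 2)%:E)%E.
Proof.
under eq_integral => l _.
  rewrite normrM (@ger0_norm _ (_ + _)^-1) ?invr_ge0 ?addr_ge0 ?sqr_ge0//.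
  rewrite -[in x ^+ 2]real_normK ?num_real//; over.
rewrite integral_cauchy lee_fin ler_piMr ?divr_ge0 ?pi_ge0//.
by rewrite sgr_norm; case: (x != 0).
Qed.

Lemma integral_norm_expRN (l : rT) (h : rT -> rT) : 0 < l -> measurable_fun setT h ->
  (forall t, `|h t| <= 1) ->
  (\int[mu]_(t in pos) `|expR (- (l * t)) * h t|%:E <= l^-1%:E)%E.
Proof.
move=> l0 mh h1; rewrite -integral_expRN//; apply: ge0_le_integral => //.
- apply/measurable_EFinP; apply: measurable_funTS.
  by apply: measurableT_comp => //; apply: measurable_funM => //; exact: measurable_expRN.
- by apply/measurable_EFinP; apply: measurable_funTS; exact: measurable_expRN.
- by move=> t _; rewrite lee_fin normrM (ger0_norm (expR_ge0 _)) ler_piMr ?expR_ge0.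
Qed.

Lemma integrable_prob_bounded (f : T -> rT) (B : rT) : measurable_fun setT f ->
  (forall w, `|f w| <= B) -> P.-integrable setT (EFin \o f).
Proof.
move=> mf fB; apply: measurable_bounded_integrable => //.
  by rewrite /= probability_setT ltry.
exists B; split; first by rewrite num_real.
by move=> x Bx w _ /=; rewrite (le_trans (fB w))// ltW.
Qed.

Lemma EFin_Rintegral_bounded (f : T -> rT) (B : rT) : measurable_fun setT f ->
  (forall w, `|f w| <= B) ->
  (\int[P]_w (f w)%:E = (Rintegral P setT f)%:E)%E.
Proof.
move=> mf fB; rewrite /Rintegral fineK//.
exact/integrable_fin_num/(integrable_prob_bounded mf fB).
Qed.

(** Adding the bound [B] makes the integrand nonnegative, so Tonelli yields measurability in [s];
    the added constant is then subtracted. *)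
Lemma measurable_sin_transform X Z (B : rT) :
  measurable_fun setT X -> measurable_fun setT Z -> (forall w, `|Z w| <= B) ->
  measurable_fun setT (fun s : rT => Rintegral P setT (fun w => sin (s * X w) * Z w)).
Proof.
move=> mX mZ ZB.
have m2 : measurable_fun setT (fun z : T * rT => sin (z.2 * X z.1) * Z z.1).
  apply: measurable_funM; last exact: (measurableT_comp mZ).
  apply: (measurableT_comp measurable_sin); apply: measurable_funM => //.
  exact: (measurableT_comp mX).
have ms s : measurable_fun setT (fun w => sin (s * X w) * Z w).
  exact: (measurable_fun_pair1 s m2).
have bs s w : `|sin (s * X w) * Z w| <= B.
  by rewrite normrM (le_trans _ (ZB w))// ler_piMl// norm_sin_le1.
apply/measurable_EFinP.
rewrite (_ : _ \o _ =
    (fun s => \int[P]_w (sin (s * X w) * Z w + B)%:E - B%:E)%E); last first.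
  apply/funext => s /=; rewrite -(EFin_Rintegral_bounded (ms s) (bs s)).
  under [in RHS]eq_integral do rewrite EFinD.
  rewrite integralD//=; last 2 first.
    exact: integrable_prob_bounded (ms s) (bs s).
    exact: finite_measure_integrable_cst.
  by rewrite integral_cst//= probability_setT mule1 addeK.
apply: emeasurable_funB => //.
have := @measurable_fun_fubini_tonelli_G _ _ _ _ _ P
  (fun z : T * rT => (sin (z.2 * X z.1) * Z z.1 + B)%:E).
apply.
  by apply/measurable_EFinP; apply: measurable_funD.
move=> z; rewrite lee_fin.
by have := bs z.2 z.1; rewrite ler_norml => /andP[]; lra.
Qed.

(* Formally this is sg x = 2/pi * int_0^oo sin(s x)/s ds under the expectation;
   as that integral is only conditionally convergent, 1/s is first written as
   int_0^oo exp(-l s) dl and the l-integral is kept outermost. *)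
Lemma sin_transform_sgr X Z (B : rT) :
  measurable_fun setT X -> measurable_fun setT Z -> (forall w, `|Z w| <= B) ->
  (forall s, 0 < s -> 0 <= Rintegral P setT (fun w => sin (s * X w) * Z w)) ->
  (\int[mu]_(s in pos) (Rintegral P setT (fun w => sin (s * X w) * Z w) / s)%:E =
   (pi / 2 * Rintegral P setT (fun w => Num.sg (X w) * Z w))%:E)%E.
Proof.
move=> mX mZ ZB psi0.
set psi := fun s => Rintegral P setT (fun w => sin (s * X w) * Z w).
have mpsi : measurable_fun setT psi by exact: measurable_sin_transform mX mZ ZB.
have msg : measurable_fun setT (fun w => Num.sg (X w) * Z w).
  by apply: measurable_funM => //; exact: (measurableT_comp (@measurable_sgr _)).
have bsg w : `|Num.sg (X w) * Z w| <= B.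
  rewrite normrM (le_trans _ (ZB w))// ler_piMl// normr_sg.
  by case: (X w == 0).
have ipos (l : rT) : l \in pos -> 0 < l by rewrite inE /= in_itv/= andbT.
symmetry.
transitivity (\int[P]_w (pi / 2 * Num.sg (X w) * Z w)%:E)%E.
  under eq_integral do rewrite -mulrA EFinM.
  rewrite integralZl//=; last exact: integrable_prob_bounded msg bsg.
  by rewrite EFinM (EFin_Rintegral_bounded msg bsg).
rewrite (@expect_integral_swap (fun w l => X w / (l ^+ 2 + X w ^+ 2))
  _ Z B (pi / 2)) //; first last.
- by move=> w; exact: integral_cauchy.
- by move=> w; exact: integral_norm_cauchy.
- apply: measurable_funM; first exact: (measurableT_comp mX).
  apply: measurable_fun_ge0V; first by move=> z; rewrite addr_ge0 ?sqr_ge0.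
  apply: measurable_funD; apply: measurable_funX => //.
  exact: (measurableT_comp mX).
(* For fixed l > 0 the Cauchy kernel is expanded as a Laplace transform, and the damping exp(-l t)
   makes the exchange with the expectation absolutely convergent. *)
transitivity (\int[mu]_(l in pos) \int[mu]_(t in pos) (expR (- (l * t)) * psi t)%:E)%E.
  apply: eq_integral => l /ipos l0.
  rewrite (@expect_integral_swap (fun w t => expR (- (l * t)) * sin (t * X w))
    _ Z B l^-1) //; first last.
  - by move=> w; exact: laplace_sin.
  - move=> w; apply: integral_norm_expRN => //; last by move=> t; exact: norm_sin_le1.
    by apply: (measurableT_comp measurable_sin); exact: measurable_funM.
  - apply: measurable_funM.
      exact: (measurableT_comp (measurable_expRN l)).
    apply: (measurableT_comp measurable_sin); apply: measurable_funM => //.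
    exact: (measurableT_comp mX).
  apply: eq_integral => t _.
  under eq_integral do rewrite -mulrA EFinM.
  have mt : measurable_fun setT (fun w => sin (t * X w) * Z w).
    apply: measurable_funM => //; apply: (measurableT_comp measurable_sin).
    exact: measurable_funM.
  have bt w : `|sin (t * X w) * Z w| <= B.
    by rewrite normrM (le_trans _ (ZB w))// ler_piMl// norm_sin_le1.
  rewrite integralZl//=; last exact: integrable_prob_bounded mt bt.
  by rewrite (EFin_Rintegral_bounded mt bt).
(* No absolute bound survives once [l] ranges over the whole half-line; the hypothesis that [psi] is
   nonnegative is what permits this exchange. *)
rewrite (@tonelli_in _ _ _ _ _ mu mu (fun l t => expR (- (l * t)) * psi t))//; first last.
- move=> l t _ /=; rewrite in_itv/= andbT => t0.
  by rewrite mulr_ge0 ?expR_ge0 ?psi0.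
- apply: measurable_funM; last exact: (measurableT_comp mpsi).
  apply: measurableT_comp => //; apply: measurableT_comp => //.
  exact: measurable_funM.
apply: eq_integral => t /ipos t0.
have eqt l : expR (- (l * t)) = expR (- (t * l)) by rewrite mulrC.
under eq_integral do rewrite EFinM eqt.
rewrite ge0_integralZr//=.
- by rewrite integral_expRN// -EFinM mulrC.
- by apply/measurable_EFinP; apply: measurable_funTS; exact: measurable_expRN.
- by rewrite lee_fin psi0.
Qed.

End sign_expectation.

(** * Gaussian, hyperbolic and arcsine integrals *)

Section gaussian_integrals.
Context (rT : realType).
Notation mu := (@lebesgue_measure rT).
Notation pos := (`]0%R, +oo[%classic : set rT).

(** Completing the square: up to the constant [k] the integrand is the normal density of mean m / b
    and variance 1 / b, whose mass is one. *)
Lemma integral_gauss_exp (b m : rT) : 0 < b ->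
  (\int[mu]_t (expR (- (b * t ^+ 2 / 2) + m * t))%:E =
   (Num.sqrt (2 * pi / b) * expR (m ^+ 2 / (2 * b)))%:E)%E.
Proof.
move=> b0.
have sb : (Num.sqrt b)^-1 != 0 :> rT by rewrite invr_neq0// sqrtr_eq0 -ltNge.
have := integral_normal_pdf (m / b) (Num.sqrt b)^-1.
rewrite normal_pdfE//.
have s2 : (Num.sqrt b)^-1 ^+ 2 = b^-1 :> rT by rewrite exprVn sqr_sqrtr// ltW.
pose k := normal_peak (Num.sqrt b)^-1 * expR (- (m ^+ 2 / (2 * b))).
have k0 : 0 < k by rewrite mulr_gt0 ?expR_gt0 ?normal_peak_gt0.
under eq_integral => t _.
  rewrite (_ : _ * _ = k * expR (- (b * t ^+ 2 / 2) + m * t)); last first.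
    rewrite /k -mulrA -expRD /normal_fun s2; congr (_ * expR _).
    by field; rewrite gt_eqF.
  rewrite EFinM; over.
rewrite ge0_integralZl//=; last 2 first.
- apply/measurable_EFinP; apply: measurableT_comp => //; apply: measurable_funD => //.
  apply: measurableT_comp => //; apply: measurable_funM => //; apply: measurable_funM => //.
- by rewrite lee_fin ltW.
move=> h.
transitivity (k^-1%:E * (k%:E * \int[mu]_t (expR (- (b * t ^+ 2 / 2) + m * t))%:E))%E.
  by rewrite muleA -EFinM mulVf ?mul1e// gt_eqF.
rewrite h mule1 /k invfM expRN invrK /normal_peak s2 invrK.
congr ((Num.sqrt _ * _)%:E); rewrite -mulr_natr; ring.
Qed.

(** The integrand is even, so the half-line carries half of the full integral, and the full integral
    averages the exponential moments at m and - m, which are equal. *)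
Lemma integral_gauss_cosh (b m : rT) : 0 < b ->
  (\int[mu]_(t in pos) (expR (- (b * t ^+ 2 / 2)) * ((expR (m * t) + expR (- (m * t))) / 2))%:E =
   (Num.sqrt (2 * pi / b) / 2 * expR (m ^+ 2 / (2 * b)))%:E)%E.
Proof.
move=> b0.
pose f (t : rT) := expR (- (b * t ^+ 2 / 2)) * ((expR (m * t) + expR (- (m * t))) / 2).
have f0 t : 0 <= f t by rewrite mulr_ge0 ?divr_ge0 ?addr_ge0 ?expR_ge0.
have cm c : continuous (fun t : rT => expR (c * t)).
  move=> t; apply: (@continuous_comp _ _ _ (fun t => c * t) expR).
    exact: mulrl_continuous.
  exact: continuous_expR.
have cb : continuous (fun t : rT => expR (- (b * t ^+ 2 / 2))).
  move=> t; apply: (@continuous_comp rT rT rT (fun t : rT => - (b * t ^+ 2 / 2)) expR);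
    last exact: continuous_expR.
  apply: cvgN; apply: cvgM; last exact: cvg_cst.
  by apply: cvgM; [exact: cvg_cst|exact: exprn_continuous].
have cf : continuous f.
  move=> t; apply: cvgM; first exact: cb.
  apply: cvgM; last exact: cvg_cst.
  apply: cvgD; first exact: cm.
  by under eq_fun do rewrite -mulNr; rewrite -mulNr; exact: cm.
have mf : measurable_fun setT f by exact: continuous_measurable_fun.
have ff : f =1 f \o -%R.
  by move=> t; rewrite /f /= sqrrN mulrN opprK addrC.
have := ge0_symfun_integralT f0 cf ff.
have -> : (\int[mu]_t (f t)%:E = (Num.sqrt (2 * pi / b) * expR (m ^+ 2 / (2 * b)))%:E)%E.
  transitivity (\int[mu]_t (2^-1%:E * ((expR (- (b * t ^+ 2 / 2) + m * t))%:E +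
      (expR (- (b * t ^+ 2 / 2) + (- m) * t))%:E)))%E.
    apply: eq_integral => t _; rewrite -EFinD -EFinM /f !expRD mulNr.
    by congr (_%:E); ring.
  have me c : measurable_fun setT (fun t : rT => (expR (- (b * t ^+ 2 / 2) + c * t))%:E).
    apply/measurable_EFinP; apply: measurableT_comp => //; apply: measurable_funD => //.
    apply: measurableT_comp => //; apply: measurable_funM => //; apply: measurable_funM => //.
  rewrite ge0_integralZl//; last 2 first.
  - by apply: emeasurable_funD; exact: me.
  - by move=> t _; rewrite adde_ge0// lee_fin expR_ge0.
  rewrite ge0_integralD//; [|exact: me|exact: me].
  by rewrite !integral_gauss_exp// sqrrN -EFinD -EFinM; congr (_%:E); field.
rewrite -set_itvcy.
rewrite -integral_itv_obnd_cbnd; last first.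
  by apply/measurable_EFinP; exact: measurable_funTS.
move=> h.
transitivity (2^-1%:E * (2%:E * \int[mu]_(t in pos) (f t)%:E))%E.
  by rewrite muleA -EFinM mulVf ?mul1e.
by rewrite -h -EFinM; congr (_%:E); ring.
Qed.

Lemma integral_gauss_half (a : rT) : 0 < a ->
  (\int[mu]_(t in pos) (expR (- (a * t ^+ 2 / 2)))%:E = (Num.sqrt (2 * pi / a) / 2)%:E)%E.
Proof.
move=> a0; have := @integral_gauss_cosh a 0 a0.
rewrite expr0n/= mul0r expR0 mulr1 => <-; apply: eq_integral => t _.
by rewrite !mul0r oppr0 expR0 (_ : (1 + 1) / 2 = 1 :> rT) ?mulr1//; field.
Qed.

Lemma integral_cosh (c u : rT) : 0 < c -> 0 < u ->
  (\int[mu]_(th in `[0%R, c]) ((expR (th * u) + expR (- (th * u))) / 2)%:E =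
   ((expR (c * u) - expR (- (c * u))) / 2 / u)%:E)%E.
Proof.
move=> c0 u0.
pose F (th : rT) := (expR (th * u) - expR (- (th * u))) / 2 / u.
have dF (th : rT) : is_derive th 1 F ((expR (th * u) + expR (- (th * u))) / 2).
  have h1 := is_derive_expRN u th; have h2 := is_derive_expRN (- u) th.
  rewrite /F (_ : (fun th => _) = (fun th => (expR (- (- u * th)) - expR (- (u * th))) / 2 / u)).
    by apply: is_derive_eq; rewrite /GRing.scale/= !mulNr opprK (mulrC u th); field; rewrite gt_eqF.
  by apply/funext => x; rewrite mulNr opprK (mulrC u x).
have cF : continuous F.
  by move=> x; apply: differentiable_continuous; apply/derivable1_diffP; have [] := dF x.
have cm (k : rT) : continuous (fun t : rT => expR (t * k)).
  move=> t; apply: (@continuous_comp rT rT rT (fun t : rT => t * k) expR).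
    exact: mulrr_continuous.
  exact: continuous_expR.
rewrite (@continuous_FTC2 _ _ F 0 c)//.
- by rewrite /F !mul0r oppr0 expR0 subrr !mul0r sube0.
- apply: continuous_subspaceT => x; apply: cvgM; last exact: cvg_cst.
  apply: cvgD; first exact: cm.
  by under eq_fun do rewrite -mulrN; rewrite -mulrN; exact: cm.
- split.
  + by move=> x _; have [] := dF x.
  + by apply: cvg_at_right_filter; exact: cF.
  + by apply: cvg_at_left_filter; exact: cF.
- by move=> x _; rewrite derive1E; have [_ ->] := dF x.
Qed.

Lemma asinN (x : rT) : -1 <= x <= 1 -> asin (- x) = - asin x.
Proof.
move=> x1; have /asin_def[/andP[h1 h2] h3] := x1.
by rewrite -[in LHS]h3 -sinN sinK// in_itv/= lerN2 h2 lerNl.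
Qed.

Lemma asin0 : asin 0 = 0 :> rT.
Proof. by rewrite -[in asin 0]sin0 sinK// in_itv/= oppr_le0 divr_ge0 ?pi_ge0. Qed.

(** The strict bound c < r keeps th / r away from 1, so the primitive asin(th / r) is differentiable
    on the whole closed interval. *)
Lemma integral_asin (c r : rT) : 0 < c < r ->
  (\int[mu]_(th in `[0%R, c]) (Num.sqrt (r ^+ 2 - th ^+ 2))^-1%:E = (asin (c / r))%:E)%E.
Proof.
move=> /andP[c0 cr].
have r0 : 0 < r by exact: lt_trans cr.
have bnd (th : rT) : 0 <= th <= c -> -1 < th / r < 1.
  move=> /andP[t0 tc]; rewrite ltr_pdivlMr// ltr_pdivrMr// mulN1r mul1r.
  by rewrite (le_lt_trans tc cr) andbT (lt_le_trans _ t0)// oppr_lt0.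
have pos1 (th : rT) : 0 <= th <= c -> 0 < r ^+ 2 - th ^+ 2.
  move=> /andP[t0 tc]; rewrite subr_gt0 ltr_pXn2r// ?nnegrE// ?(ltW r0)//.
  exact: le_lt_trans cr.
pose F (th : rT) := asin (th / r).
have dF (th : rT) : 0 <= th <= c -> is_derive th 1 F (Num.sqrt (r ^+ 2 - th ^+ 2))^-1.
  move=> tc.
  have h : is_derive th 1 (fun t : rT => t / r) r^-1.
    by apply: is_derive_eq; rewrite /GRing.scale/= mulr1 ?mulr0 ?add0r.
  have H := @is_derive1_comp _ (@asin rT) (fun t : rT => t / r) th _ _
    (is_derive1_asin (bnd _ tc)) h.
  apply: (is_derive_eq H); rewrite -invfM; congr (_^-1).
  rewrite -[X in _ * X](ger0_norm (ltW r0)) -sqrtr_sqr -sqrtrM.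
    by congr Num.sqrt; field; rewrite gt_eqF.
  by have /andP[] := bnd _ tc; set y := th / r => h1 h2; nra.
have cF (th : rT) : 0 <= th <= c -> {for th, continuous F}.
  by move=> tc; apply: differentiable_continuous; apply/derivable1_diffP; have [] := dF _ tc.
rewrite (@continuous_FTC2 _ _ F 0 c)//.
- by rewrite /F mul0r asin0 sube0.
- apply: continuous_in_subspaceT => x; rewrite inE/= in_itv/= => xc.
  apply: cvgV; first by rewrite gt_eqF// sqrtr_gt0 pos1.
  apply: (@continuous_comp rT rT rT (fun x : rT => r ^+ 2 - x ^+ 2) Num.sqrt);
    last exact: sqrt_continuous.
  by apply: cvgD; [exact: cvg_cst|apply: cvgN; exact: exprn_continuous].
- split.
  + move=> x; rewrite in_itv/= => /andP[x0 xc].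
    have xc' : 0 <= x <= c by rewrite !ltW.
    by have [] := dF x xc'.
  + by apply: cvg_at_right_filter; apply: cF; rewrite lexx ltW.
  + by apply: cvg_at_left_filter; apply: cF; rewrite lexx ltW.
- move=> x; rewrite in_itv/= => /andP[x0 xc]; rewrite derive1E.
  have xc' : 0 <= x <= c by rewrite !ltW.
  by have [_ ->] := dF x xc'.
Qed.
End gaussian_integrals.

(** * The arcsine law *)

Section arcsine_law.
Context (rT : realType).
Notation mu := (@lebesgue_measure rT).
Notation pos := (`]0%R, +oo[%classic : set rT).

(** With 0 <= c every integrand is nonnegative, so the three integrations may be reordered freely;
    c^2 < a b keeps the quadratic form positive definite for each th in [0, c], so the Gaussian
    integrals converge. *)
Lemma integral_gauss_sinh (a b c : rT) : 0 < a -> 0 < b -> 0 <= c -> c ^+ 2 < a * b ->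
  (\int[mu]_(s in pos) \int[mu]_(t in pos)
     (expR (- (a * s ^+ 2 / 2)) * expR (- (b * t ^+ 2 / 2)) *
      ((expR (c * (s * t)) - expR (- (c * (s * t)))) / 2) / (s * t))%:E =
   (pi / 2 * asin (c / Num.sqrt (a * b)))%:E)%E.
Proof.
move=> a0 b0; rewrite le_eqVlt => /predU1P[<- _|c0 cab].
  rewrite mul0r asin0 mulr0 integral0_eq// => s _; rewrite integral0_eq// => t _.
  by rewrite mul0r oppr0 subrr !(mul0r, mulr0).
have ab0 : 0 < a * b by rewrite mulr_gt0.
have ipos (l : rT) : l \in pos -> 0 < l by rewrite inE /= in_itv/= andbT.
pose g (th s t : rT) := expR (- (a * s ^+ 2 / 2)) * expR (- (b * t ^+ 2 / 2)) *
  ((expR (th * (s * t)) + expR (- (th * (s * t)))) / 2).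
(* [h] is [g] after the integration in t: completing the square there lowers the coefficient of s^2
   from a to a - th^2 / b. *)
pose h (th s : rT) := Num.sqrt (2 * pi / b) / 2 * expR (- ((a - th ^+ 2 / b) * s ^+ 2 / 2)).
have m2 (q : rT) : measurable_fun setT (fun t : rT => expR (- (q * t ^+ 2 / 2))).
  apply: measurableT_comp => //; apply: measurableT_comp => //.
  by apply: measurable_funM => //; apply: measurable_funM.
have mch (x : rT) : measurable_fun setT (fun t : rT => (expR (x * t) + expR (- (x * t))) / 2).
  apply: measurable_funM => //; apply: measurable_funD.
    by apply: measurableT_comp => //; apply: measurable_funM.
  by apply: measurableT_comp => //; apply: measurableT_comp => //; apply: measurable_funM.
transitivity (\int[mu]_(s in pos) \int[mu]_(th in `[0%R, c]) (h th s)%:E)%E.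
  apply: eq_integral => s /ipos s0.
  transitivity (\int[mu]_(t in pos) \int[mu]_(th in `[0%R, c]) (g th s t)%:E)%E.
    apply: eq_integral => t /ipos t0; rewrite /g.
    under eq_integral do rewrite EFinM.
    rewrite ge0_integralZl//=.
    - rewrite integral_cosh ?mulr_gt0// -EFinM; congr (_%:E).
      by field; rewrite !gt_eqF.
    - apply/measurable_EFinP; apply: measurable_funTS.
      under eq_fun do rewrite (mulrC _ (s * t)); exact: mch.
  rewrite (@tonelli_in _ _ _ _ _ mu mu (fun t th => g th s t))//; first last.
  - by move=> t th _ _; rewrite /g !mulr_ge0 ?divr_ge0 ?addr_ge0 ?expR_ge0.
  - apply: measurable_funM.
      by apply: measurable_funM => //; exact: (measurableT_comp (m2 b)).
    apply: measurable_funM => //; apply: measurable_funD.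
      by apply: measurableT_comp => //; apply: measurable_funM => //; apply: measurable_funM.
    apply: measurableT_comp => //; apply: measurableT_comp => //.
    by apply: measurable_funM => //; apply: measurable_funM.
  apply: eq_integral => th _; rewrite /g.
  under eq_integral => t _.
    rewrite -mulrA (mulrA th s t) EFinM; over.
  rewrite ge0_integralZl//=.
  - rewrite integral_gauss_cosh// -EFinM /h; congr (_%:E).
    rewrite mulrCA; congr (_ * _); rewrite -expRD; congr expR.
    by field; rewrite gt_eqF.
  - apply/measurable_EFinP; apply: measurable_funTS.
    by apply: measurable_funM; [exact: m2|exact: mch].
rewrite (@tonelli_in _ _ _ _ _ mu mu (fun s th => h th s))//; first last.
- by move=> s th _ _; rewrite /h mulr_ge0 ?divr_ge0 ?sqrtr_ge0 ?expR_ge0.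
- apply: measurable_funM => //; apply: measurableT_comp => //; apply: measurableT_comp => //.
  apply: measurable_funM => //; apply: measurable_funM => //; last exact: measurable_funX.
  apply: measurable_funB => //; apply: measurable_funM => //; exact: measurable_funX.
transitivity (\int[mu]_(th in `[0%R, c])
    ((pi / 2)%:E * (Num.sqrt (Num.sqrt (a * b) ^+ 2 - th ^+ 2))^-1%:E))%E.
  apply: eq_integral => th; rewrite inE/= in_itv/= => /andP[t0 tc].
  have th2 : th ^+ 2 < a * b.
    by apply: le_lt_trans cab; rewrite ler_pXn2r ?nnegrE// (le_trans t0).
  have q0 : 0 < a - th ^+ 2 / b by rewrite subr_gt0 ltr_pdivrMr.
  have d0 : 0 < a * b - th ^+ 2 by rewrite subr_gt0.
  rewrite /h; under eq_integral do rewrite EFinM.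
  rewrite ge0_integralZl//=.
  - rewrite integral_gauss_half// -!EFinM; congr (_%:E).
    rewrite sqr_sqrtr ?(ltW ab0)//.
    rewrite mulrACA -sqrtrM; last by rewrite divr_ge0 ?mulr_ge0 ?pi_ge0// ltW.
    (* The two Gaussian variances multiply to 1 / (a b - th^2); with the two halves from the
       half-lines, 2 pi / 4 is the factor pi / 2. *)
    rewrite [X in Num.sqrt X](_ : _ = (2 * pi) ^+ 2 * (a * b - th ^+ 2)^-1); last first.
      by field; rewrite !gt_eqF// mulrC.
    rewrite sqrtrM ?sqr_ge0// sqrtr_sqr ger0_norm ?mulr_ge0 ?pi_ge0//.
    rewrite sqrtrV ?(ltW d0)//; field.
    by rewrite gt_eqF// sqrtr_gt0.
  - by apply/measurable_EFinP; apply: measurable_funTS; exact: m2.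
rewrite ge0_integralZl//=.
- rewrite integral_asin// c0/= -(ltr_pXn2r (_ : 0 < 2)%N)// ?nnegrE ?sqrtr_ge0 ?(ltW c0)//.
  by rewrite sqr_sqrtr// ltW.
- apply/measurable_EFinP; apply: measurable_funTS; apply: measurable_fun_ge0V.
    by move=> x; exact: sqrtr_ge0.
  apply: (@measurableT_comp _ _ _ _ _ _ (@Num.sqrt rT)).
    by apply: continuous_measurable_fun; exact: sqrt_continuous.
  by apply: measurable_funB => //; exact: measurable_funX.
- by rewrite lee_fin divr_ge0// pi_ge0.
Qed.

(** On the open half-line s equals |s|, whose inverse is covered by the nonnegative case. *)
Lemma measurable_div_pos (f : rT -> rT) :
  measurable_fun setT f -> measurable_fun pos (fun s => f s / s).
Proof.
move=> mf; apply: (eq_measurable_fun (fun s => f s / `|s|)).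
  by move=> s; rewrite inE/= in_itv/= andbT => s0; rewrite gtr0_norm.
apply: measurable_funTS; apply: measurable_funM => //.
by apply: measurable_fun_ge0V => //; exact: measurable_normr.
Qed.

Context d (T : measurableType d) (P : probability T rT).

(* Only the even part of the joint characteristic function of a centred Gaussian
   pair is recorded: it is all that the sign correlations depend on. *)
Definition gauss_pair (X Y : T -> rT) (a b c : rT) := forall s t : rT,
  Rintegral P setT (fun w => cos (s * X w + t * Y w)) =
  expR (- (a * s ^+ 2 + 2 * c * s * t + b * t ^+ 2) / 2).

(** Product-to-sum turns the two sines into half the difference of cosines at (s, -t) and (s, t),
    which the joint characteristic function supplies. *)
Lemma expect_sin_sin (X Y : T -> rT) (a b c s t : rT) :
  measurable_fun setT X -> measurable_fun setT Y -> gauss_pair X Y a b c ->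
  Rintegral P setT (fun w => sin (t * Y w) * sin (s * X w)) =
  expR (- (a * s ^+ 2 / 2)) * expR (- (b * t ^+ 2 / 2)) *
      ((expR (c * (s * t)) - expR (- (c * (s * t)))) / 2).
Proof.
move=> mX mY gXY.
have mc (u v : rT) : measurable_fun setT (fun w => cos (u * X w + v * Y w)).
  apply: (measurableT_comp measurable_cos); apply: measurable_funD; exact: measurable_funM.
have ic u v := integrable_prob_bounded P (mc u v) (fun w => norm_cos_le1 _).
transitivity (Rintegral P setT (fun w =>
    2^-1 * (cos (s * X w + (- t) * Y w) - cos (s * X w + t * Y w)))).
  by apply: eq_Rintegral => w _; rewrite mulNr cosB cosD; field.
set D := fun w => cos (s * X w + (- t) * Y w) - cos (s * X w + t * Y w).
have -> : Rintegral P setT (fun w => 2^-1 * D w) = 2^-1 * Rintegral P setT D.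
  apply: RintegralZl => //.
  by apply: (@integrableB _ _ _ P setT measurableT) (ic s (- t)) (ic s t).
rewrite /D.
rewrite RintegralB//.
rewrite !gXY mulrC mulrA mulrBr -!expRD.
by congr ((expR _ - expR _) / _); field.
Qed.

(** The sine transform is applied twice, first to replace the sign of [Y], then that of [X]. Each
    use requires a nonnegative transform. *)
Lemma expect_sgr_sgr_ge0 (X Y : T -> rT) (a b c : rT) :
  measurable_fun setT X -> measurable_fun setT Y -> gauss_pair X Y a b c ->
  0 < a -> 0 < b -> 0 <= c -> c ^+ 2 < a * b ->
  Rintegral P setT (fun w => Num.sg (X w) * Num.sg (Y w)) =
  2 / pi * asin (c / Num.sqrt (a * b)).
Proof.
move=> mX mY gXY a0 b0 c0 cab.
have ipos (l : rT) : l \in pos -> 0 < l by rewrite inE /= in_itv/= andbT.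
have pi0 := pi_gt0 rT.
have msY : measurable_fun setT (fun w => Num.sg (Y w)).
  exact: (measurableT_comp (@measurable_sgr _)).
have bsY w : `|Num.sg (Y w)| <= 1 by rewrite normr_sg; case: (Y w == 0).
have ms s : measurable_fun setT (fun w => sin (s * X w)).
  by apply: (measurableT_comp measurable_sin); exact: measurable_funM.
(* The sign of [c] enters here: the closed form contains sinh(c s t). *)
have phi0 s t : 0 < s -> 0 < t ->
    0 <= Rintegral P setT (fun w => sin (t * Y w) * sin (s * X w)).
  move=> s0 t0; rewrite (expect_sin_sin s t mX mY gXY).
  rewrite mulr_ge0// ?mulr_ge0 ?expR_ge0// subr_ge0 ler_expR.
  by rewrite ge0_cp// !mulr_ge0// ltW.
have psiE s : 0 < s ->
    (\int[mu]_(t in pos)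
     (expR (- (a * s ^+ 2 / 2)) * expR (- (b * t ^+ 2 / 2)) *
      ((expR (c * (s * t)) - expR (- (c * (s * t)))) / 2) / t)%:E =
    (pi / 2 * Rintegral P setT (fun w => sin (s * X w) * Num.sg (Y w)))%:E)%E.
  move=> s0; under eq_Rintegral do rewrite mulrC.
  rewrite -(sin_transform_sgr mY (ms s) (fun w => norm_sin_le1 _))//.
    by apply: eq_integral => t _; rewrite (expect_sin_sin s t mX mY gXY).
  by move=> t; exact: phi0.
(* Positivity of the second transform is inherited, since by [psiE] it is an integral of the
   first. *)
have psi0 s : 0 < s -> 0 <= Rintegral P setT (fun w => sin (s * X w) * Num.sg (Y w)).
  move=> s0.
  rewrite -(@pmulr_rge0 _ (pi / 2)) ?divr_gt0// -lee_fin -psiE//.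
  apply: integral_ge0 => t; rewrite /= in_itv/= andbT => t0.
  by rewrite lee_fin divr_ge0 ?(ltW t0)// -(expect_sin_sin s t mX mY gXY) phi0.
have mpsi := measurable_sin_transform P mX msY bsY.
have : (\int[mu]_(s in pos) ((pi / 2)%:E *
    (Rintegral P setT (fun w => sin (s * X w) * Num.sg (Y w)) / s)%:E) =
   (pi / 2 * asin (c / Num.sqrt (a * b)))%:E)%E.
  rewrite -integral_gauss_sinh//; apply: eq_integral => s /ipos s0.
  transitivity (s^-1%:E * (pi / 2 * Rintegral P setT (fun w => sin (s * X w) * Num.sg (Y w)))%:E)%E.
    by rewrite -!EFinM; congr (_%:E); field; rewrite !gt_eqF.
  rewrite -psiE// -ge0_integralZl//=; first last.
  - by rewrite lee_fin invr_ge0 ltW.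
  - move=> t; rewrite in_itv/= andbT => t0.
    by rewrite lee_fin divr_ge0 ?(ltW t0)// -(expect_sin_sin s t mX mY gXY) phi0.
  - apply/measurable_EFinP; apply: measurable_div_pos.
    under eq_fun do rewrite -(expect_sin_sin s _ mX mY gXY).
    exact: measurable_sin_transform mY (ms s) (fun w => norm_sin_le1 _).
  apply: eq_integral => t /ipos t0; rewrite -EFinM; congr (_%:E).
  by field; rewrite !gt_eqF.
rewrite ge0_integralZl//=; first last.
- by rewrite lee_fin divr_ge0// ltW.
- move=> s; rewrite in_itv/= andbT => s0.
  by rewrite lee_fin divr_ge0 ?(ltW s0)// psi0.
- by apply/measurable_EFinP; exact: measurable_div_pos.
rewrite (sin_transform_sgr mX msY bsY psi0) -EFinM => -[h].
have p2 : pi / 2 != 0 :> rT by rewrite gt_eqF// divr_gt0.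
apply: (mulfI p2); apply: (mulfI p2).
by rewrite h -(invf_div pi 2) mulVKf.
Qed.

(** For c < 0, replacing [Y] by its opposite changes the sign of the covariance, and both sides are
    odd under this reflection. *)
Lemma expect_sgr_sgr (X Y : T -> rT) (a b c : rT) :
  measurable_fun setT X -> measurable_fun setT Y -> gauss_pair X Y a b c ->
  0 < a -> 0 < b -> c ^+ 2 < a * b ->
  Rintegral P setT (fun w => Num.sg (X w) * Num.sg (Y w)) =
  2 / pi * asin (c / Num.sqrt (a * b)).
Proof.
move=> mX mY gXY a0 b0 cab.
have [c0|c0] := leP 0 c; first exact: expect_sgr_sgr_ge0.
have mNY : measurable_fun setT (fun w => - Y w) by exact: measurableT_comp.
have gXNY : gauss_pair X (fun w => - Y w) a b (- c).
  move=> s t; have := gXY s (- t).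
  under eq_Rintegral do rewrite mulNr -mulrN.
  by move=> ->; congr expR; ring.
have := @expect_sgr_sgr_ge0 X (fun w => - Y w) a b (- c) mX mNY gXNY a0 b0.
rewrite sqrrN oppr_ge0 ltW// => /(_ isT cab).
have ab0 : 0 < a * b by rewrite mulr_gt0.
have sab0 : 0 < Num.sqrt (a * b) by rewrite sqrtr_gt0.
rewrite mulNr asinN; last first.
  rewrite ler_pdivlMr// ler_pdivrMr// mulN1r mul1r -ler_norml.
  rewrite -(ler_pXn2r (_ : 0 < 2)%N)// ?nnegrE// ?(ltW sab0)//.
  by rewrite real_normK ?num_real// sqr_sqrtr ltW.
have mS : measurable_fun setT (fun w => Num.sg (X w) * Num.sg (Y w)).
  by apply: measurable_funM; exact: (measurableT_comp (@measurable_sgr _)).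
have bS w : `|Num.sg (X w) * Num.sg (Y w)| <= 1.
  by rewrite normrM !normr_sg; case: (_ == 0); case: (_ == 0); rewrite ?mul0r ?mulr0 ?mulr1.
have -> : Rintegral P setT (fun w => Num.sg (X w) * Num.sg (- Y w)) =
    (-1) * Rintegral P setT (fun w => Num.sg (X w) * Num.sg (Y w)).
  under eq_Rintegral do rewrite sgrN mulrN -mulN1r.
  by apply: RintegralZl => //; exact: integrable_prob_bounded mS bS.
by rewrite mulN1r mulrN => /oppr_inj.
Qed.

(** On the event X = 0 the kernel l / (l^2 + X^2) equals 1 / l, while its expectation is the
    integral of exp(-l t) exp(-a t^2 / 2), at most a constant [C] that does not depend on l. Hence
    P(X = 0) <= l C for every l > 0. *)
Lemma gauss_neq0 (X : T -> rT) (a : rT) : measurable_fun setT X -> 0 < a ->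
  (forall s, Rintegral P setT (fun w => cos (s * X w)) = expR (- (a * s ^+ 2 / 2))) ->
  P (X @^-1` [set 0]) = 0%E.
Proof.
move=> mX a0 cX.
have mX0 : measurable (X @^-1` [set 0]).
  by rewrite -[X in measurable X]setTI; exact: mX.
set C := Num.sqrt (2 * pi / a) / 2; set X0 := X @^-1` _.
have bound (l : rT) : 0 < l -> (P X0 <= (l * C)%:E)%E.
  move=> l0.
  have ml : measurable_fun setT (fun w => l / (l ^+ 2 + X w ^+ 2)).
    apply: measurable_funM => //; apply: measurable_fun_ge0V.
      by move=> w; rewrite addr_ge0 ?sqr_ge0.
    by apply: measurable_funD => //; exact: measurable_funX.
  have l0' w : 0 <= l / (l ^+ 2 + X w ^+ 2).
    by rewrite divr_ge0 ?addr_ge0 ?sqr_ge0// ltW.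
  have h1 : (\int[P]_w (l / (l ^+ 2 + X w ^+ 2))%:E <= C%:E)%E.
    (* The spurious factor 1 plays the bounded variable [Z] in the exchange lemma. *)
    under eq_integral do rewrite -[l / _]mulr1.
    rewrite (@expect_integral_swap _ _ _ P (fun w t => expR (- (l * t)) * cos (t * X w)) _
      (fun=> 1) 1 l^-1) //; first last.
    - by move=> w; exact: laplace_cos.
    - move=> w; apply: integral_norm_expRN => //; last by move=> t; exact: norm_cos_le1.
      by apply: (measurableT_comp measurable_cos); exact: measurable_funM.
    - by move=> w; rewrite normr1.
    - apply: measurable_funM.
        exact: (measurableT_comp (measurable_expRN l)).
      apply: (measurableT_comp measurable_cos); apply: measurable_funM => //.
      exact: (measurableT_comp mX).
    rewrite /C -integral_gauss_half//.
    have ma : measurable_fun setT (fun t : rT => expR (- (a * t ^+ 2 / 2))).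
      apply: measurableT_comp => //; apply: measurableT_comp => //.
      by apply: measurable_funM => //; apply: measurable_funM.
    have -> : (\int[mu]_(t in pos) \int[P]_w (expR (- (l * t)) * cos (t * X w) * 1)%:E =
        \int[mu]_(t in pos) (expR (- (l * t)) * expR (- (a * t ^+ 2 / 2)))%:E)%E.
      apply: eq_integral => t _; under eq_integral do rewrite mulr1 EFinM.
      have mt : measurable_fun setT (fun w => cos (t * X w)).
        by apply: (measurableT_comp measurable_cos); exact: measurable_funM.
      have bt w : `|cos (t * X w)| <= 1 by exact: norm_cos_le1.
      rewrite integralZl//=; last exact: integrable_prob_bounded mt bt.
      by rewrite (EFin_Rintegral_bounded P mt bt) cX.
    apply: ge0_le_integral => //.
    - apply/measurable_EFinP; apply: measurable_funTS; apply: measurable_funM => //.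
      exact: measurable_expRN.
    - by apply/measurable_EFinP; apply: measurable_funTS.
    - move=> t; rewrite /= in_itv/= andbT => t0; rewrite lee_fin ler_piMl ?expR_ge0//.
      by rewrite -expR0 ler_expR oppr_le0 mulr_ge0// ltW.
  have h2 : (P X0 * l^-1%:E <= C%:E)%E.
    apply: le_trans h1.
    rewrite muleC -[X in (_ * P X)%E]setIT -integral_indic// -ge0_integralZl//=; last 2 first.
    - by apply/measurable_EFinP; exact: measurable_indic.
    - by rewrite lee_fin invr_ge0 ltW.
    apply: ge0_le_integral => //.
    - by move=> w _; rewrite mule_ge0 ?lee_fin ?invr_ge0 ?(ltW l0)// indicE.
    - apply/measurable_EFinP; apply: measurable_funM => //; exact: measurable_indic.
    - exact/measurable_EFinP.
    - move=> w _; rewrite -EFinM lee_fin indicE.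
      have [|_] := boolP (w \in _); last by rewrite mulr0.
      rewrite inE/= => ->; rewrite expr0n/= addr0 mulr1 expr2 invfM mulrA divff ?gt_eqF//.
      by rewrite mul1r.
  move: h2; rewrite -(fineK (fin_num_measure P _ mX0)) -EFinM !lee_fin.
  by rewrite ler_pdivrMr// mulrC.
apply/eqP; rewrite eq_le measure_ge0 andbT.
have C0 : 0 < C by rewrite divr_gt0// sqrtr_gt0 divr_gt0// mulr_gt0// pi_gt0.
apply/lee_addgt0Pr => e e0; rewrite add0e.
by have := bound (e / C); rewrite divfK ?gt_eqF//; apply; rewrite divr_gt0.
Qed.

Lemma expect_sgr_sqr (X : T -> rT) (a : rT) : measurable_fun setT X -> 0 < a ->
  (forall s, Rintegral P setT (fun w => cos (s * X w)) = expR (- (a * s ^+ 2 / 2))) ->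
  Rintegral P setT (fun w => Num.sg (X w) * Num.sg (X w)) = 1.
Proof.
move=> mX a0 cX; have PX0 := gauss_neq0 mX a0 cX.
rewrite /Rintegral; apply: EFin_inj.
rewrite (ae_eq_integral (cst 1%E))//.
- by rewrite integral_cst//= probability_setT mule1.
- apply/measurable_EFinP.
  by apply: measurable_funM; exact: (measurableT_comp (@measurable_sgr _)).
- exists (X @^-1` [set 0]); split => //.
    by rewrite -[X in measurable X]setTI; exact: mX.
  move=> w /= h; apply: contrapT => Xw; apply: h => _.
  congr (_%:E); rewrite -expr2 sqr_sg; case: eqP Xw => //.
Qed.

End arcsine_law.

(** * Quantised complex Gaussian vectors *)

Section complex_parts.
Implicit Types a b : C.

Lemma ReD a b : complex.Re (a + b) = complex.Re a + complex.Re b.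
Proof. by case: a; case: b. Qed.

Lemma ImD a b : complex.Im (a + b) = complex.Im a + complex.Im b.
Proof. by case: a; case: b. Qed.

Lemma ReM a b : complex.Re (a * b) =
  complex.Re a * complex.Re b - complex.Im a * complex.Im b.
Proof. by case: a; case: b. Qed.

Lemma ImM a b : complex.Im (a * b) =
  complex.Re a * complex.Im b + complex.Im a * complex.Re b.
Proof. by case: a; case: b. Qed.

Lemma Re_conjc a : complex.Re (conjc a) = complex.Re a.
Proof. by case: a. Qed.

Lemma Im_conjc a : complex.Im (conjc a) = - complex.Im a.
Proof. by case: a. Qed.

Lemma conjcM a b : conjc (a * b) = conjc a * conjc b.
Proof. exact: rmorphM. Qed.

Lemma Re_sum I (r : seq I) (Q : pred I) (F : I -> C) :
  complex.Re (\sum_(i <- r | Q i) F i) = \sum_(i <- r | Q i) complex.Re (F i).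
Proof. by apply: (big_morph _ ReD). Qed.

Lemma complex_ext a b : complex.Re a = complex.Re b -> complex.Im a = complex.Im b -> a = b.
Proof. by case: a; case: b => ? ? ? ? /= -> ->. Qed.

Lemma conjc_eq_real a : conjc a = a -> a = (complex.Re a)%:C%C.
Proof.
case: a => u v [] h; apply: complex_ext => //=.
by apply/eqP; rewrite -eqNr h.
Qed.

(** Links the complex roots in the normalisations of [Ap], [zeta] and [eta] to the real roots of the
    arcsine law. *)
Lemma sqrtC_real (r : R) : 0 <= r -> sqrtC (r%:C%C : C) = (Num.sqrt r)%:C%C.
Proof.
move=> r0; rewrite -[in LHS](sqr_sqrtr r0) rmorphXn /= sqrCK//.
by rewrite ler0c sqrtr_ge0.
Qed.

End complex_parts.

Section conjugate_transpose.
Implicit Types m n p : nat.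

Lemma ctrE m n (A : 'M[C]_(m, n)) i j : ctr A i j = conjc (A j i).
Proof. by rewrite !mxE. Qed.

Lemma ctrM m n p (A : 'M[C]_(m, n)) (B : 'M[C]_(n, p)) : ctr (A *m B) = ctr B *m ctr A.
Proof. by rewrite /ctr /conjm map_mxM trmx_mul. Qed.

Lemma ctrK m n (A : 'M[C]_(m, n)) : ctr (ctr A) = A.
Proof. by apply/matrixP => i j; rewrite !ctrE conjcK. Qed.

Lemma ctrZ m n (a : C) (A : 'M[C]_(m, n)) : ctr (a *: A) = conjc a *: ctr A.
Proof. by apply/matrixP => i j; rewrite !mxE rmorphM. Qed.

Lemma ctrD m n (A B : 'M[C]_(m, n)) : ctr (A + B) = ctr A + ctr B.
Proof. by apply/matrixP => i j; rewrite !mxE rmorphD. Qed.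

Lemma ctr0 m n : ctr (0 : 'M[C]_(m, n)) = 0.
Proof. by apply/matrixP => i j; rewrite !mxE rmorph0. Qed.

Lemma ctr1 n : ctr (1%:M : 'M[C]_n) = 1%:M.
Proof. by apply/matrixP => i j; rewrite !mxE eq_sym rmorph_nat. Qed.

Lemma ctr_col_mx m1 m2 n (A : 'M[C]_(m1, n)) (B : 'M[C]_(m2, n)) :
  ctr (col_mx A B) = row_mx (ctr A) (ctr B).
Proof. by rewrite /ctr /conjm map_col_mx tr_col_mx. Qed.

Lemma ctr_block_mx m1 m2 n1 n2 (A : 'M[C]_(m1, n1)) (B : 'M[C]_(m1, n2))
    (D : 'M[C]_(m2, n1)) (E : 'M[C]_(m2, n2)) :
  ctr (block_mx A B D E) = block_mx (ctr A) (ctr D) (ctr B) (ctr E).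
Proof. by rewrite /ctr /conjm map_block_mx tr_block_mx. Qed.

Lemma ctr_inv n (A : 'M[C]_n) : ctr (invmx A) = invmx (ctr A).
Proof. by rewrite /ctr /conjm map_invmx trmx_inv. Qed.

Lemma ctr_delta n (i : 'I_n) : ctr (delta_mx i 0 : 'cV[C]_n) = delta_mx 0 i.
Proof. by apply/matrixP => a b; rewrite !mxE rmorph_nat andbC. Qed.

End conjugate_transpose.

(** * The Hermitian form of a covariance matrix *)

Section hermitian_form.
Variables (n : nat) (S : 'M[C]_n).
Implicit Types p q : 'cV[C]_n.

(** If [S] is the covariance of a centred vector W, this is the correlation of p^H W with q^H W. *)
Definition form p q : C := (ctr p *m S *m q) 0 0.

Lemma formDl p1 p2 q : form (p1 + p2) q = form p1 q + form p2 q.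
Proof. by rewrite /form ctrD !mulmxDl mxE. Qed.

Lemma formDr p q1 q2 : form p (q1 + q2) = form p q1 + form p q2.
Proof. by rewrite /form mulmxDr mxE. Qed.

Lemma formZl (a : C) p q : form (a *: p) q = conjc a * form p q.
Proof. by rewrite /form ctrZ -!scalemxAl mxE. Qed.

Lemma formZr (a : C) p q : form p (a *: q) = a * form p q.
Proof. by rewrite /form -scalemxAr mxE. Qed.

Hypothesis herm : ctr S = S.

Lemma form_conj p q : conjc (form p q) = form q p.
Proof.
rewrite /form -ctrE !ctrM ctrK herm mulmxA; done.
Qed.

Lemma form_self p : form p p = (complex.Re (form p p))%:C%C.
Proof. by apply: conjc_eq_real; exact: form_conj. Qed.

Lemma Re_form_comb (s t : R) p q :
  complex.Re (form (s%:C%C *: p + t%:C%C *: q) (s%:C%C *: p + t%:C%C *: q)) =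
  s ^+ 2 * complex.Re (form p p) + 2 * s * t * complex.Re (form p q)
  + t ^+ 2 * complex.Re (form q q).
Proof.
rewrite !(formDl, formDr, formZl, formZr) -(form_conj p q).
by rewrite !(ReD, ReM, ImM, Re_conjc, Im_conjc) /=; ring.
Qed.

(* The two unit summands are the noise variances: they keep every correlation
   coefficient strictly inside (-1, 1), where the arcsine is differentiable. *)
Lemma noisy_cauchy_schwarz p q :
  (forall v, 0 <= complex.Re (form v v)) ->
  complex.Re (form p q) ^+ 2 <
    (complex.Re (form p p) + 1) * (complex.Re (form q q) + 1).
Proof.
move=> psd.
(* The usual Cauchy-Schwarz test vector with Re(q^H S q) + 1 in place of Re(q^H S q): the later
   division by it never meets a degenerate form. *)
have := psd ((complex.Re (form q q) + 1)%:C%C *: p + (- complex.Re (form p q))%:C%C *: q).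
rewrite Re_form_comb.
have := psd p; have := psd q.
move: (complex.Re (form q q)) (complex.Re (form p q)) (complex.Re (form p p)).
move=> c b a c0 a0 h.
have h1 : 0 <= (c + 1) * (a * (c + 1) - b ^+ 2) by nra.
have h2 : 0 <= a * (c + 1) - b ^+ 2 by rewrite -(pmulr_rge0 _ (_ : 0 < c + 1))//; lra.
nra.
Qed.

(** Circular symmetry: a phase leaves the quadratic form unchanged, so real and imaginary parts of a
    sample have equal variance. *)
Lemma form_scale_i p : form ('i%C *: p) ('i%C *: p) = form p p.
Proof.
rewrite formZl formZr mulrA (_ : conjc 'i%C * 'i%C = 1 :> C) ?mul1r//.
by apply: complex_ext; rewrite ?ReM ?ImM /=; ring.
Qed.

Lemma noisy_cauchy_schwarz_Im p q :
  (forall v, 0 <= complex.Re (form v v)) ->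
  complex.Im (form p q) ^+ 2 <
    (complex.Re (form p p) + 1) * (complex.Re (form q q) + 1).
Proof.
move=> psd; have := noisy_cauchy_schwarz ('i%C *: p) q psd.
rewrite form_scale_i; congr (_ ^+ 2 < _).
by rewrite formZl ReM /=; ring.
Qed.

End hermitian_form.

Section flat_index.
Variables a b : nat.

Lemma unvecK (i : 'I_a) (j : 'I_b) : unvec (mxvec_index i j) = (i, j).
Proof. by rewrite /unvec /mxvec_index cast_ordK enum_rankK. Qed.

Lemma mxvec_indexK (i : 'I_(a * b)) : mxvec_index (unvec i).1 (unvec i).2 = i.
Proof. by rewrite /unvec /mxvec_index -surjective_pairing enum_valK cast_ordKV. Qed.

Lemma sum_unvec (F : 'I_a -> 'I_b -> C) :
  \sum_i F (unvec i).1 (unvec i).2 = \sum_i \sum_j F i j.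
Proof.
rewrite pair_big /= (reindex (fun ij : 'I_a * 'I_b => mxvec_index ij.1 ij.2)) /=.
  by apply: eq_bigr => -[i j] _; rewrite unvecK.
exists (@unvec a b) => [[i j] _|i _]; first exact: unvecK.
exact: mxvec_indexK.
Qed.

End flat_index.

(** * Expectation of bounded complex random variables *)

Section complex_expectation.
Context d (T : measurableType d) (Pr : probability T R).
Implicit Types f g : T -> C.

(** Boundedness is chosen over integrability because it is stable under products as well as sums and
    conjugation, and quantised samples have it at once. *)
Definition bounded_rv f :=
  [/\ measurable_fun setT ((fun w => complex.Re (f w)) : T -> (R : realType)),
      measurable_fun setT ((fun w => complex.Im (f w)) : T -> (R : realType)) &
      exists B : R, forall w, `|complex.Re (f w)| <= B /\ `|complex.Im (f w)| <= B].

Lemma bounded_rv_integrable f : bounded_rv f ->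
  Pr.-integrable setT (EFin \o (fun w => complex.Re (f w))) /\
  Pr.-integrable setT (EFin \o (fun w => complex.Im (f w))).
Proof.
move=> [mr mi [B fB]]; split.
  by apply: (@integrable_prob_bounded _ _ _ Pr _ B) => // w; have [] := fB w.
by apply: (@integrable_prob_bounded _ _ _ Pr _ B) => // w; have [] := fB w.
Qed.

Lemma bounded_rv_cst (c : C) : bounded_rv (fun=> c).
Proof.
split; [exact: measurable_cst|exact: measurable_cst|].
exists (`|complex.Re c| + `|complex.Im c|) => w.
by rewrite lerDl lerDr !normr_ge0.
Qed.

Lemma bounded_rvD f g : bounded_rv f -> bounded_rv g -> bounded_rv (fun w => f w + g w).
Proof.
move=> [mr mi [B fB]] [mr' mi' [B' gB]]; split.
- by under eq_fun do rewrite ReD; exact: measurable_funD.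
- by under eq_fun do rewrite ImD; exact: measurable_funD.
exists (B + B') => w; have [? ?] := fB w; have [? ?] := gB w.
by rewrite ReD ImD !(le_trans (ler_normD _ _))// lerD.
Qed.

Lemma bounded_rvM f g : bounded_rv f -> bounded_rv g -> bounded_rv (fun w => f w * g w).
Proof.
move=> [mr mi [B fB]] [mr' mi' [B' gB]]; split.
- by under eq_fun do rewrite ReM; apply: measurable_funB; exact: measurable_funM.
- by under eq_fun do rewrite ImM; apply: measurable_funD; exact: measurable_funM.
exists (B * B' + B * B') => w; have [? ?] := fB w; have [? ?] := gB w.
rewrite ReM ImM (le_trans (ler_normB _ _)) ?(le_trans (ler_normD _ _))//.
  by rewrite !normrM lerD// ler_pM.
by rewrite !normrM lerD// ler_pM.
Qed.

Lemma bounded_rv_conj f : bounded_rv f -> bounded_rv (fun w => conjc (f w)).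
Proof.
move=> [mr mi [B fB]]; split.
- by under eq_fun do rewrite Re_conjc.
- under eq_fun do rewrite Im_conjc.
  exact: measurable_funN mi.
by exists B => w; rewrite Re_conjc Im_conjc normrN.
Qed.

Lemma bounded_rv_sum I (r : seq I) (F : I -> T -> C) :
  (forall i, bounded_rv (F i)) -> bounded_rv (fun w => \sum_(i <- r) F i w).
Proof.
move=> bF; elim: r => [|i r IH].
  by under eq_fun do rewrite big_nil; exact: bounded_rv_cst.
by under eq_fun do rewrite big_cons; exact: bounded_rvD.
Qed.

Lemma cexpect_ReIm f : cexpect Pr f =
  Complex (Rintegral Pr setT (fun w => complex.Re (f w)))
          (Rintegral Pr setT (fun w => complex.Im (f w))).
Proof. by rewrite /cexpect; apply: complex_ext; rewrite ?ReD ?ReM ?ImD ?ImM /=; ring. Qed.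

Lemma eq_cexpect f g : f =1 g -> cexpect Pr f = cexpect Pr g.
Proof. by move=> /funext ->. Qed.

Lemma cexpectD f g : bounded_rv f -> bounded_rv g ->
  cexpect Pr (fun w => f w + g w) = cexpect Pr f + cexpect Pr g.
Proof.
move=> /bounded_rv_integrable[fr fi] /bounded_rv_integrable[gr gi].
rewrite !cexpect_ReIm; apply: complex_ext; rewrite ?ReD ?ImD /=.
  by under eq_Rintegral do rewrite ReD; exact: RintegralD.
by under eq_Rintegral do rewrite ImD; exact: RintegralD.
Qed.

Lemma cexpectZ (c : C) f : bounded_rv f ->
  cexpect Pr (fun w => c * f w) = c * cexpect Pr f.
Proof.
move=> /bounded_rv_integrable[fr fi].
have Z (k : R) (g : T -> R) : Pr.-integrable setT (EFin \o g) ->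
    Pr.-integrable setT (EFin \o (fun w => k * g w)).
  by move=> ig; exact: (@integrableZl _ _ _ Pr setT measurableT k (EFin \o g)).
rewrite !cexpect_ReIm; apply: complex_ext; rewrite ?ReM ?ImM /=.
  under eq_Rintegral do rewrite ReM.
  by rewrite RintegralB ?RintegralZl//; exact: Z.
under eq_Rintegral do rewrite ImM.
by rewrite RintegralD ?RintegralZl//; exact: Z.
Qed.

Lemma cexpect_conj f : bounded_rv f ->
  cexpect Pr (fun w => conjc (f w)) = conjc (cexpect Pr f).
Proof.
move=> /bounded_rv_integrable[fr fi].
rewrite !cexpect_ReIm; apply: complex_ext; rewrite ?Re_conjc ?Im_conjc /=.
  by under eq_Rintegral do rewrite Re_conjc.
under eq_Rintegral do rewrite Im_conjc -mulN1r.
by rewrite RintegralZl// mulN1r.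
Qed.

Lemma cexpect_sum I (r : seq I) (F : I -> T -> C) :
  (forall i, bounded_rv (F i)) ->
  cexpect Pr (fun w => \sum_(i <- r) F i w) = \sum_(i <- r) cexpect Pr (F i).
Proof.
move=> bF; elim: r => [|i r IH].
  rewrite big_nil cexpect_ReIm; under eq_Rintegral do rewrite big_nil.
  under [X in Complex _ X]eq_Rintegral do rewrite big_nil.
  by rewrite /= /Rintegral integral0 /=.
rewrite big_cons -IH -cexpectD//; last exact: bounded_rv_sum.
by apply: eq_cexpect => w; rewrite big_cons.
Qed.

Lemma cexpect_trace m n (B : 'M[C]_(m, n)) (F : T -> 'M[C]_(n, m)) :
  (forall i j, bounded_rv (fun w => F w i j)) ->
  cexpect Pr (fun w => \tr (B *m F w)) = \tr (B *m cexpect_mx Pr F).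
Proof.
move=> bF; rewrite /mxtrace.
have bBF i j : bounded_rv (fun w => B i j * F w j i).
  by apply: bounded_rvM => //; exact: bounded_rv_cst.
rewrite cexpect_sum; last first.
  by move=> i; under eq_fun do rewrite mxE; exact: bounded_rv_sum.
apply: eq_bigr => i _; rewrite mxE.
under eq_cexpect do rewrite mxE.
rewrite cexpect_sum//; apply: eq_bigr => j _.
by rewrite cexpectZ// mxE.
Qed.

End complex_expectation.

(** * Correlations of one-bit quantised observations *)

Section quantised_gaussian.
Context d (T : measurableType d) (Pr : probability T R).
Variables (n : nat) (W : T -> 'cV[C]_n) (S : 'M[C]_n).
Hypotheses (WS : is_CN Pr W S) (herm : ctr S = S).
Implicit Types p q : 'cV[C]_n.

Definition obs p w : C := (ctr p *m W w) 0 0.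

Lemma obsD p q w : obs (p + q) w = obs p w + obs q w.
Proof. by rewrite /obs ctrD mulmxDl mxE. Qed.

Lemma obsZ (a : C) p w : obs (a *: p) w = conjc a * obs p w.
Proof. by rewrite /obs ctrZ -scalemxAl mxE. Qed.

(** [obs] is antilinear in [p], so the factor i comes out as -i. Imaginary parts thereby need no
    arcsine law of their own. *)
Lemma Im_obs p w : complex.Im (obs p w) = complex.Re (obs ('i%C *: p) w).
Proof. by rewrite obsZ ReM /=; ring. Qed.

Lemma measurable_Re_obs p :
  measurable_fun setT ((fun w => complex.Re (obs p w)) : T -> (R : realType)).
Proof.
have -> : (fun w => complex.Re (obs p w)) = (fun w => \sum_i
    (complex.Re (p i 0) * complex.Re (W w i 0) + complex.Im (p i 0) * complex.Im (W w i 0))).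
  apply/funext => w; rewrite /obs mxE Re_sum; apply: eq_bigr => i _.
  by rewrite ctrE ReM Re_conjc Im_conjc; ring.
apply: measurable_sum => i; have [mr mi] := WS.1 i.
by apply: measurable_funD; exact: measurable_funM.
Qed.

(** The halves reflect that a real part carries half of the complex variance; they cancel in the
    correlation coefficient. *)
Lemma gauss_pair_obs p q :
  gauss_pair Pr (fun w => complex.Re (obs p w)) (fun w => complex.Re (obs q w))
    (complex.Re (form S p p) / 2) (complex.Re (form S q q) / 2)
    (complex.Re (form S p q) / 2).
Proof.
move=> s t; have [+ _] := WS.2 (s%:C%C *: p + t%:C%C *: q).
rewrite -/(form S _ _) Re_form_comb// => h.
transitivity (expR (- (s ^+ 2 * complex.Re (form S p p) + 2 * s * t * complex.Re (form S p q)
  + t ^+ 2 * complex.Re (form S q q)) / 4)); last by congr expR; field.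
rewrite -h; apply: eq_Rintegral => w _; congr cos.
by rewrite -/(obs _ w) obsD !obsZ ReD !ReM !Re_conjc !Im_conjc /=; ring.
Qed.

Lemma expect_sgr_Re_obs p q :
  0 < complex.Re (form S p p) -> 0 < complex.Re (form S q q) ->
  complex.Re (form S p q) ^+ 2 < complex.Re (form S p p) * complex.Re (form S q q) ->
  Rintegral Pr setT
    (fun w => Num.sg (complex.Re (obs p w)) * Num.sg (complex.Re (obs q w))) =
  Omega (complex.Re (form S p q) /
    Num.sqrt (complex.Re (form S p p) * complex.Re (form S q q))).
Proof.
move=> p0 q0 pq.
rewrite (expect_sgr_sgr (measurable_Re_obs p) (measurable_Re_obs q) (gauss_pair_obs p q)).
- rewrite /Omega; congr (_ * asin _).
  set a := complex.Re (form S p p) in p0 pq *; set b := complex.Re (form S q q) in q0 pq *.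
  rewrite (_ : a / 2 * (b / 2) = 2^-1 ^+ 2 * (a * b)); last by field.
  rewrite sqrtrM ?sqr_ge0// sqrtr_sqr ger0_norm ?invr_ge0//.
  field; rewrite sqrtr_eq0 -ltNge; nra.
- by rewrite divr_gt0.
- by rewrite divr_gt0.
- nra.
Qed.

Definition sgc (c : C) : C := Complex (Num.sg (complex.Re c)) (Num.sg (complex.Im c)).

Lemma quantE rho K c : quant rho K c = (Num.sqrt ((rho * K%:R + 1) / 2))%:C%C * sgc c.
Proof.
by rewrite /quant; congr (_ * _); apply: complex_ext; rewrite ?ReD ?ImD ?ReM ?ImM /=; ring.
Qed.

Lemma sgr_bounded (x : R) : `|Num.sg x| <= 1.
Proof. by rewrite normr_sg; case: (x == 0). Qed.

Lemma integrable_sgr_obs p q : Pr.-integrable setT (EFin \o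
  (fun w => Num.sg (complex.Re (obs p w)) * Num.sg (complex.Re (obs q w)))).
Proof.
apply: (@integrable_prob_bounded _ _ _ Pr _ 1).
  apply: measurable_funM.
    exact: (measurableT_comp (@measurable_sgr R) (measurable_Re_obs p)).
  exact: (measurableT_comp (@measurable_sgr R) (measurable_Re_obs q)).
by move=> w; rewrite normrM mulr_ile1// sgr_bounded.
Qed.

Lemma bounded_rv_sgc p : bounded_rv (fun w => sgc (obs p w)).
Proof.
split.
- exact: (measurableT_comp (@measurable_sgr R) (measurable_Re_obs p)).
- under eq_fun do rewrite /= Im_obs.
  exact: (measurableT_comp (@measurable_sgr R) (measurable_Re_obs ('i%C *: p))).
- by exists 1 => w /=; rewrite !sgr_bounded.
Qed.

Lemma bounded_rv_quant rho K p : bounded_rv (fun w => quant rho K (obs p w)).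
Proof.
under eq_fun do rewrite quantE.
by apply: bounded_rvM; [exact: bounded_rv_cst|exact: bounded_rv_sgc].
Qed.

Lemma cexpect_quant_sgc rho (K : nat) p q : 0 < rho ->
  cexpect Pr (fun w => quant rho K (obs p w) * conjc (quant rho K (obs q w))) =
  ((rho * K%:R + 1) / 2)%:C%C * cexpect Pr (fun w => sgc (obs p w) * conjc (sgc (obs q w))).
Proof.
move=> rho0; rewrite -cexpectZ; last first.
  by apply: bounded_rvM; [|apply: bounded_rv_conj]; exact: bounded_rv_sgc.
apply: eq_cexpect => w; rewrite !quantE conjcM conjc_real mulrACA -rmorphM.
by rewrite -expr2 sqr_sqrtr// divr_ge0// addr_ge0// mulr_ge0// ltW.
Qed.

(** Of the four real sign correlations, Re-Re and Im-Im coincide while the two mixed ones are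
    opposite. Each part of the product thus counts twice, which the 1/2 in the squared amplitude
    compensates. *)
Lemma cexpect_quant rho (K : nat) p q : 0 < rho ->
  0 < complex.Re (form S p p) -> 0 < complex.Re (form S q q) ->
  complex.Re (form S p q) ^+ 2 < complex.Re (form S p p) * complex.Re (form S q q) ->
  complex.Im (form S p q) ^+ 2 < complex.Re (form S p p) * complex.Re (form S q q) ->
  let N := Num.sqrt (complex.Re (form S p p) * complex.Re (form S q q)) in
  cexpect Pr (fun w => quant rho K (obs p w) * conjc (quant rho K (obs q w))) =
  (rho * K%:R + 1)%:C%C * Complex (Omega (complex.Re (form S p q) / N))
                                  (Omega (complex.Im (form S p q) / N)).
Proof.
move=> rho0 p0 q0 Rpq Ipq N.
have Nneg : - complex.Im (form S p q) / N = - (complex.Im (form S p q) / N) by rewrite mulNr.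
have N0 : 0 < N by rewrite sqrtr_gt0 mulr_gt0.
pose ip := 'i%C *: p; pose iq := 'i%C *: q.
have fpp : form S ip ip = form S p p by exact: form_scale_i.
have fqq : form S iq iq = form S q q by exact: form_scale_i.
have fii : form S ip iq = form S p q.
  by rewrite formZl formZr mulrA (_ : conjc 'i%C * 'i%C = 1 :> C) ?mul1r//;
    apply: complex_ext; rewrite ?ReM ?ImM /=; ring.
have fip : complex.Re (form S ip q) = complex.Im (form S p q).
  by rewrite formZl ReM /=; ring.
have fiq : complex.Re (form S p iq) = - complex.Im (form S p q).
  by rewrite formZr ReM /=; ring.
rewrite cexpect_quant_sgc// cexpect_ReIm.
have -> : Rintegral Pr setT (fun w => complex.Re (sgc (obs p w) * conjc (sgc (obs q w)))) =
    2 * Omega (complex.Re (form S p q) / N).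
  under eq_Rintegral do rewrite ReM Re_conjc Im_conjc /= mulrN opprK !Im_obs.
  rewrite RintegralD//; [|exact: integrable_sgr_obs|exact: integrable_sgr_obs].
  rewrite expect_sgr_Re_obs// expect_sgr_Re_obs -/ip -/iq ?fpp ?fqq ?fii//.
  by rewrite -/N; ring.
have -> : Rintegral Pr setT (fun w => complex.Im (sgc (obs p w) * conjc (sgc (obs q w)))) =
    2 * Omega (complex.Im (form S p q) / N).
  under eq_Rintegral do rewrite ImM Re_conjc Im_conjc /= mulrN addrC !Im_obs.
  rewrite RintegralB//; [|exact: integrable_sgr_obs|exact: integrable_sgr_obs].
  rewrite expect_sgr_Re_obs -/ip -/iq ?fpp ?fqq ?fip//.
  rewrite expect_sgr_Re_obs -/ip -/iq ?fpp ?fqq ?fiq ?sqrrN//.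
  rewrite -/N Nneg /Omega asinN; first by ring.
  rewrite ler_pdivlMr// ler_pdivrMr// mulN1r mul1r -ler_norml.
  rewrite -(ler_pXn2r (_ : 0 < 2)%N)// ?nnegrE// ?(ltW N0)//.
  by rewrite real_normK ?num_real// sqr_sqrtr ?ltW// mulr_gt0.
by apply: complex_ext; rewrite !(ReM, ImM) /=; field.
Qed.

(** Here the correlation coefficient is 1, outside the strict range of the arcsine law; squared
    signs equal one almost surely instead. *)
Lemma cexpect_quant_self rho (K : nat) p : 0 < rho -> 0 < complex.Re (form S p p) ->
  cexpect Pr (fun w => quant rho K (obs p w) * conjc (quant rho K (obs p w))) =
  (rho * K%:R + 1)%:C%C.
Proof.
move=> rho0 p0; pose ip := 'i%C *: p.
have one (v : 'cV[C]_n) : complex.Re (form S v v) = complex.Re (form S p p) ->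
    Rintegral Pr setT (fun w => Num.sg (complex.Re (obs v w)) * Num.sg (complex.Re (obs v w))) = 1.
  move=> v0; apply: (@expect_sgr_sqr _ _ _ Pr _ (complex.Re (form S v v) / 2)).
  - exact: measurable_Re_obs.
  - by rewrite v0 divr_gt0.
  - move=> s; have := gauss_pair_obs v v s 0.
    under eq_Rintegral do rewrite mul0r addr0.
    by move=> ->; congr expR; field.
rewrite cexpect_quant_sgc// cexpect_ReIm.
have -> : Rintegral Pr setT (fun w => complex.Re (sgc (obs p w) * conjc (sgc (obs p w)))) = 2.
  under eq_Rintegral do rewrite ReM Re_conjc Im_conjc /= mulrN opprK !Im_obs.
  rewrite RintegralD//; [|exact: integrable_sgr_obs|exact: integrable_sgr_obs].
  by rewrite !one// form_scale_i.
have -> : Rintegral Pr setT (fun w => complex.Im (sgc (obs p w) * conjc (sgc (obs p w)))) = 0.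
  under eq_Rintegral do rewrite ImM Re_conjc Im_conjc /= mulrN mulrC addNr.
  by rewrite /Rintegral integral0.
by apply: complex_ext; rewrite !(ReM, ImM) /=; field.
Qed.

End quantised_gaussian.

(** * The uplink model *)

Section channel_covariance.
Variables (M K : nat) (Ch : 'I_K -> 'M[C]_M).
Hypothesis Ch_psd : forall l, herm_psd (Ch l).

Definition block (l : 'I_K) (p : 'cV[C]_(K * M)) : 'cV[C]_M :=
  \col_m p (mxvec_index l m) 0.

Lemma formE n (S : 'M[C]_n) (p q : 'cV[C]_n) :
  form S p q = \sum_i \sum_j conjc (p i 0) * S i j * q j 0.
Proof.
rewrite /form mxE exchange_big /=; apply: eq_bigr => j _.
by rewrite mxE mulr_suml; apply: eq_bigr => i _; rewrite ctrE.
Qed.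

Lemma form_blkdiag (p q : 'cV[C]_(K * M)) :
  form (blkdiag Ch) p q = \sum_l form (Ch l) (block l p) (block l q).
Proof.
rewrite formE.
pose G l m l' m' := conjc (p (mxvec_index l m) 0) *
  (if l == l' then Ch l m m' else 0) * q (mxvec_index l' m') 0.
transitivity (\sum_(i < K * M) \sum_l' \sum_m' G (unvec i).1 (unvec i).2 l' m').
  apply: eq_bigr => i _; rewrite -(sum_unvec (G (unvec i).1 (unvec i).2)).
  by apply: eq_bigr => j _; rewrite /G !mxvec_indexK mxE.
rewrite (sum_unvec (fun l m => \sum_l' \sum_m' G l m l' m')) /G.
apply: eq_bigr => l _; rewrite formE; apply: eq_bigr => m _.
rewrite (bigD1 l)//= [X in _ + X]big1 ?addr0; last first.
  by move=> l' ll'; rewrite big1// => m' _; rewrite eq_sym (negbTE ll') mulr0 mul0r.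
by apply: eq_bigr => m' _; rewrite eqxx !mxE.
Qed.

Lemma blkdiag_psd p : 0 <= complex.Re (form (blkdiag Ch) p p).
Proof.
rewrite form_blkdiag Re_sum sumr_ge0// => l _.
by have [_ +] := Ch_psd l; apply.
Qed.

Lemma blkdiag_herm : ctr (blkdiag Ch) = blkdiag Ch.
Proof.
apply/matrixP => i j; rewrite ctrE !mxE eq_sym.
have [e|_] := eqVneq; last by rewrite conjc0.
have [h _] := Ch_psd (unvec i).1.
by rewrite -[in RHS]h ctrE e.
Qed.

(** The Kronecker product of f with the m-th unit vector: paired with vec(H), it combines the users
    seen by antenna m. *)
Definition hvec (m : 'I_M) (f : 'I_K -> C) : 'cV[C]_(K * M) :=
  \col_i (f (unvec i).1 * ((unvec i).2 == m)%:R).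

Lemma block_hvec l m f : block l (hvec m f) = f l *: delta_mx m 0.
Proof. by apply/matrixP => i j; rewrite !mxE unvecK !ord1 andbT. Qed.

Lemma form_delta n (S : 'M[C]_n) (i j : 'I_n) :
  form S (delta_mx i 0) (delta_mx j 0) = S i j.
Proof. by rewrite /form ctr_delta -rowE -colE !mxE. Qed.

Lemma form_hvec (m n : 'I_M) (f g : 'I_K -> C) :
  form (blkdiag Ch) (hvec m f) (hvec n g) = \sum_l conjc (f l) * g l * Ch l m n.
Proof.
rewrite form_blkdiag; apply: eq_bigr => l _.
by rewrite !block_hvec formZl formZr form_delta mulrA.
Qed.

Lemma ctr_hvec_vecm (m : 'I_M) (f : 'I_K -> C) (H : 'M[C]_(M, K)) :
  (ctr (hvec m f) *m vecm H) 0 0 = \sum_l conjc (f l) * H m l.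
Proof.
rewrite mxE.
under eq_bigr do rewrite !mxE.
rewrite (@sum_unvec K M (fun l m' => conjc (f l * (m' == m)%:R) * H m' l)).
apply: eq_bigr => l _; rewrite (bigD1 m)//= big1 ?addr0; last first.
  by move=> m' /negbTE ->; rewrite mulr0 conjc0 mul0r.
by rewrite eqxx mulr1.
Qed.

End channel_covariance.

(** * Received samples as observations of one Gaussian vector *)

Section observations.
Variables (M K tau : nat) (rho : R) (Ch : 'I_K -> 'M[C]_M).
Context d (T : measurableType d) (Pr : probability T R).
Variables (Hm : T -> 'M[C]_(M, K)) (Zp : T -> 'M[C]_(M, tau)) (z : T -> 'cV[C]_M).
Hypotheses (rho0 : 0 < rho) (Ch_psd : forall l, herm_psd (Ch l)).

Definition source w := col_mx (col_mx (vecm (Hm w)) (vecm (Zp w))) (z w).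
(** In a jointly Gaussian vector the zero off-diagonal blocks express the mutual independence of
    channel, pilot noise and data noise. *)
Definition source_cov : 'M[C]_(K * M + tau * M + M) :=
  block_mx (block_mx (blkdiag Ch) 0 0 1%:M) 0 0 1%:M.

Hypothesis source_CN : is_CN Pr source source_cov.

Lemma source_cov_herm : ctr source_cov = source_cov.
Proof. by rewrite /source_cov !ctr_block_mx !ctr0 !ctr1 blkdiag_herm. Qed.

Definition stack (h : 'cV[C]_(K * M)) (e : 'cV[C]_(tau * M)) (e' : 'cV[C]_M) :=
  col_mx (col_mx h e) e'.

Lemma form_stack h1 e1 e1' h2 e2 e2' :
  form source_cov (stack h1 e1 e1') (stack h2 e2 e2') =
  form (blkdiag Ch) h1 h2 + (ctr e1 *m e2) 0 0 + (ctr e1' *m e2') 0 0.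
Proof.
rewrite /form /stack !ctr_col_mx !mul_row_block !mul_row_col.
by rewrite !(mulmx0, mulmx1, addr0, add0r) mul_row_col !mxE.
Qed.

Lemma obs_stack h e e' w : obs source (stack h e e') w =
  (ctr h *m vecm (Hm w)) 0 0 + (ctr e *m vecm (Zp w)) 0 0 + (ctr e' *m z w) 0 0.
Proof. by rewrite /obs /source /stack !ctr_col_mx !mul_row_col !mxE. Qed.

Lemma ctr_delta_mul n (i : 'I_n) (v : 'cV[C]_n) : (ctr (delta_mx i 0 : 'cV[C]_n) *m v) 0 0 = v i 0.
Proof. by rewrite ctr_delta -rowE mxE. Qed.

Definition signal m f := (Num.sqrt rho)%:C%C *: @hvec M K m f.

Lemma form_signal m n f g : form (blkdiag Ch) (signal m f) (signal n g) =
  rho%:C%C * \sum_l conjc (f l) * g l * Ch l m n.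
Proof.
rewrite formZl formZr form_hvec mulrA conjc_real -rmorphM -expr2 sqr_sqrtr//.
exact: ltW.
Qed.

(* Since [obs p] is p^H times the source vector, the coefficients of an
   observation enter p conjugated: P_ul here, conj(x_l) in [data_vec]. *)
Definition pilot_vec (P : 'M[C]_(tau, K)) (i : 'I_(tau * M)) :=
  stack (signal (unvec i).2 (P (unvec i).1)) (delta_mx i 0) 0.

Definition data_vec (x : 'cV[C]_K) (m : 'I_M) :=
  stack (signal m (fun l => conjc (x l 0))) 0 (delta_mx m 0).

Lemma obs_pilot P i w :
  obs source (pilot_vec P i) w =
  vecm ((Num.sqrt rho)%:C%C *: (Hm w *m ctr P) + Zp w) i 0.
Proof.
rewrite obs_stack ctr_delta_mul ctr0 mul0mx [X in _ + X]mxE addr0.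
rewrite ctrZ conjc_real -scalemxAl mxE ctr_hvec_vecm !mxE.
by congr (_ * _ + _); apply: eq_bigr => l _; rewrite ctrE mulrC.
Qed.

Lemma obs_data x m w :
  obs source (data_vec x m) w = ((Num.sqrt rho)%:C%C *: (Hm w *m x) + z w) m 0.
Proof.
rewrite obs_stack ctr_delta_mul ctr0 mul0mx [X in _ + X + _]mxE addr0.
rewrite ctrZ conjc_real -scalemxAl mxE ctr_hvec_vecm !mxE.
by congr (_ * _ + _); apply: eq_bigr => l _; rewrite conjcK mulrC.
Qed.

(** The three hypotheses say that the two samples carry unit, uncorrelated noise: it adds 1 to each
    variance and nothing to the covariance. The oddness of [Omega] is returned as well, because the
    bound on the imaginary part that it requires is available here. *)
Lemma cexpect_quant_stack h1 e1 e1' h2 e2 e2' :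
  (ctr e1 *m e1) 0 0 + (ctr e1' *m e1') 0 0 = 1 ->
  (ctr e2 *m e2) 0 0 + (ctr e2' *m e2') 0 0 = 1 ->
  (ctr e1 *m e2) 0 0 + (ctr e1' *m e2') 0 0 = 0 ->
  let a1 := complex.Re (form (blkdiag Ch) h1 h1) + 1 in
  let a2 := complex.Re (form (blkdiag Ch) h2 h2) + 1 in
  let g := form (blkdiag Ch) h1 h2 / (Num.sqrt (a1 * a2))%:C%C in
  cexpect Pr (fun w => quant rho K (obs source (stack h1 e1 e1') w) *
                       conjc (quant rho K (obs source (stack h2 e2 e2') w))) =
  (rho * K%:R + 1)%:C%C * Complex (Omega (complex.Re g)) (Omega (complex.Im g))
  /\ Omega (- complex.Im g) = - Omega (complex.Im g).
Proof.
move=> n1 n2 n12 a1 a2 g.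
have herm := blkdiag_herm Ch_psd; have psd := blkdiag_psd Ch_psd.
have a1E : complex.Re (form source_cov (stack h1 e1 e1') (stack h1 e1 e1')) = a1.
  by rewrite form_stack -addrA n1 ReD.
have a2E : complex.Re (form source_cov (stack h2 e2 e2') (stack h2 e2 e2')) = a2.
  by rewrite form_stack -addrA n2 ReD.
have gE : form source_cov (stack h1 e1 e1') (stack h2 e2 e2') = form (blkdiag Ch) h1 h2.
  by rewrite form_stack -addrA n12 addr0.
have a10 : 0 < a1 by rewrite ltr_wpDl.
have a20 : 0 < a2 by rewrite ltr_wpDl.
have N0 : 0 < Num.sqrt (a1 * a2) by rewrite sqrtr_gt0 mulr_gt0.
have gN : g = Complex (complex.Re (form (blkdiag Ch) h1 h2) / Num.sqrt (a1 * a2))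
                (complex.Im (form (blkdiag Ch) h1 h2) / Num.sqrt (a1 * a2)).
  rewrite /g -fmorphV /=; apply: complex_ext; rewrite ?ReM ?ImM /=; ring.
have Rlt := noisy_cauchy_schwarz herm h1 h2 psd.
have Ilt := noisy_cauchy_schwarz_Im herm h1 h2 psd.
split.
  rewrite (cexpect_quant source_CN source_cov_herm K rho0) ?a1E ?a2E ?gE//.
  by rewrite gN.
rewrite /Omega asinN ?mulrN// gN /= ler_pdivlMr// ler_pdivrMr// mulN1r mul1r -ler_norml.
rewrite -(ler_pXn2r (_ : 0 < 2)%N)// ?nnegrE// ?(ltW N0)//.
by rewrite real_normK ?num_real// sqr_sqrtr ?ltW// mulr_gt0.
Qed.

End observations.

Unset Implicit Arguments.

(** * The mean of the MRC estimate and the two covariance matrices *)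

Theorem theorem1
  (M K tau : nat) (rho : R) (Ch : 'I_K -> 'M[C]_M) (P : 'M[C]_(tau, K))
  (x : 'cV[C]_K)
  (d : measure_display) (T : measurableType d) (Pr : probability T R)
  (Hm : T -> 'M[C]_(M, K)) (Zp : T -> 'M[C]_(M, tau)) (z : T -> 'cV[C]_M)
  (k : 'I_K) :
  0 < rho ->
  (forall l, herm_psd (Ch l)) ->
  (K <= tau)%N ->
  (forall l l' : 'I_K, l != l' -> ctr (col l P) *m col l' P = 0) ->
  (forall u l, `|P u l| = 1) ->
  (* h = vec(H) ~ CN(0, C_h) (h_1..h_K independent, h_k ~ CN(0,C_hk)),
     z_p ~ CN(0, I), z ~ CN(0, I), all mutually independent *)
  is_CN Pr (fun w => col_mx (col_mx (vecm (Hm w)) (vecm (Zp w))) (z w))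
        (block_mx (block_mx (blkdiag Ch) 0 0 1%:M) 0 0 1%:M) ->
  let sr := (Num.sqrt rho)%:C%C in
  let c0 := (rho * K%:R + 1)%:C%C in
  let Pbar := kron P (1%:M : 'M[C]_M) in
  let Pbark := castmx (erefl (tau * M)%N, mul1n M)
                 (kron (col k P) (1%:M : 'M[C]_M)) in
  let Cyp := rho%:C%C *: (conjm Pbar *m blkdiag Ch *m Pbar^T) + 1%:M in
  let Ap : 'M[C]_(tau * M) :=
    diag_mx (\row_i ((Num.sqrt (2 / pi * (rho * K%:R + 1)))%:C%C
                      / sqrtC (Cyp i i))) in
  let Yp w := sr *: (Hm w *m ctr P) + Zp w in
  let rp w := map_mx (quant rho K) (vecm (Yp w)) in
  let Crp := cexpect_mx Pr (fun w => rp w *m ctr (rp w)) in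
  let y w := sr *: (Hm w *m x) + z w in
  let r w := map_mx (quant rho K) (y w) in
  let Crrp := cexpect_mx Pr (fun w => r w *m ctr (rp w)) in
  let hhat w := sr *: (Ch k *m Pbark^T *m Ap *m invmx Crp *m rp w) in
  let xhat w := (ctr (hhat w) *m r w) 0 0 in
  let alpha (m : 'I_M) := (rho%:C%C *: (\sum_l Ch l) + 1%:M) m m in
  let beta (m : 'I_M) :=
    (rho%:C%C *: (\sum_l (`|x l 0| ^+ 2) *: Ch l) + 1%:M) m m in
  let zeta m n u v := rho%:C%C / sqrtC (alpha m * alpha n) *
    (\sum_l (P u l * (P v l)^*%C) *: (Ch l)^T) m n in
  let eta m n u := rho%:C%C / sqrtC (alpha n * beta m) *
    (\sum_l (x l 0 * P u l) *: Ch l) m n in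
  Crp \in unitmx ->
  cexpect Pr xhat = sr * \tr (invmx Crp *m Ap *m conjm Pbark *m Ch k *m Crrp)
  /\ (forall (m n : 'I_M) (u v : 'I_tau),
        Crp (mxvec_index u m) (mxvec_index v n) =
        if (m == n) && (u == v) then c0
        else c0 * ((Omega (complex.Re (zeta m n u v)))%:C%C
                   - 'i%C * (Omega (complex.Im (zeta m n u v)))%:C%C))
  /\ (forall (m n : 'I_M) (u : 'I_tau),
        Crrp m (mxvec_index u n) =
        c0 * ((Omega (complex.Re (eta m n u)))%:C%C
              + 'i%C * (Omega (complex.Im (eta m n u)))%:C%C)).
Proof.
move=> rho0 Ch_psd _ _ P1 W sr c0 Pbar Pbark Cyp Ap Yp rp Crp y r Crrp hhat xhat
  alpha beta zeta eta _.
pose src := source Hm Zp z.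
pose pv := @pilot_vec M K tau rho P; pose dv := @data_vec M K tau rho x.
have herm := blkdiag_herm Ch_psd; have psd := blkdiag_psd Ch_psd.
have rpE w i : rp w i 0 = quant rho K (obs src (pv i) w).
  by rewrite /rp mxE obs_pilot.
have rE w m : r w m 0 = quant rho K (obs src (dv m) w).
  by rewrite /r mxE obs_data.
have b_rp i : bounded_rv (fun w => rp w i 0).
  by under eq_fun do rewrite rpE; exact: bounded_rv_quant W _ _ _.
have b_r m : bounded_rv (fun w => r w m 0).
  by under eq_fun do rewrite rE; exact: bounded_rv_quant W _ _ _.
have CrpE i j : Crp i j = cexpect Pr (fun w => rp w i 0 * conjc (rp w j 0)).
  by rewrite /Crp mxE; apply: eq_cexpect => w; rewrite mxE big_ord1 ctrE.
have CrrpE m j : Crrp m j = cexpect Pr (fun w => r w m 0 * conjc (rp w j 0)).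
  by rewrite /Crrp mxE; apply: eq_cexpect => w; rewrite mxE big_ord1 ctrE.
split; [|split].
- have Crp_herm : ctr Crp = Crp.
    apply/matrixP => i j; rewrite ctrE !CrpE -cexpect_conj; last first.
      by apply: bounded_rvM => //; exact: bounded_rv_conj.
    by apply: eq_cexpect => w; rewrite conjcM conjcK mulrC.
  have Ap_herm : ctr Ap = Ap.
    (* Each diagonal entry is a Hermitian form plus one, hence a positive real; its complex square
       root is then real and [Ap] is a real diagonal matrix. *)
    have CypE j : Cyp j j =
        (rho * complex.Re (form (blkdiag Ch) (col j Pbar^T) (col j Pbar^T)) + 1)%:C%C.
      rewrite rmorphD rmorphM rmorph1 /= -(form_self herm) /form.
      rewrite !mxE eqxx; congr (_ * _ + _).
      apply: eq_bigr => a _; rewrite !mxE; congr (_ * _).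
      by apply: eq_bigr => b _; rewrite !mxE.
    rewrite /Ap; set D := \row_i _.
    have DE j : conjc (D 0 j) = D 0 j.
      rewrite mxE CypE sqrtC_real; last by rewrite addr_ge0// mulr_ge0// ltW.
      by rewrite -fmorphV -rmorphM conjc_real.
    apply/matrixP => i j; rewrite ctrE ![diag_mx _ _ _]mxE eq_sym.
    have [->|_] := eqVneq i j; last by rewrite !mulr0n conjc0.
    by rewrite !mulr1n DE.
  have [Chk _] := Ch_psd k.
  set G := Ch k *m Pbark^T *m Ap *m invmx Crp.
  have GE : ctr G = invmx Crp *m Ap *m conjm Pbark *m Ch k.
    rewrite /G !ctrM Chk Ap_herm ctr_inv Crp_herm !mulmxA; congr (_ *m _ *m _).
    by rewrite /ctr /conjm map_trmx trmxK.
  (* A scalar is its own trace; cyclicity brings the two random vectors together, leaving an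
     expression linear in r r_p^H. *)
  transitivity (cexpect Pr (fun w => sr * \tr (ctr G *m (r w *m ctr (rp w))))).
    apply: eq_cexpect => w; rewrite /xhat /hhat -/G ctrZ conjc_real -scalemxAl mxE.
    by congr (_ * _); rewrite ctrM mulmxA mxtrace_mulC mulmxA [RHS]trace_mx11.
  have b_F i j : bounded_rv (fun w => (r w *m ctr (rp w)) i j).
    under eq_fun do rewrite mxE big_ord1 ctrE.
    by apply: bounded_rvM => //; exact: bounded_rv_conj.
  rewrite cexpectZ; last first.
    rewrite /mxtrace; apply: bounded_rv_sum => i; under eq_fun do rewrite mxE.
    apply: bounded_rv_sum => j; apply: bounded_rvM => //; exact: bounded_rv_cst.
  by rewrite cexpect_trace// GE.
- move=> m n u v; rewrite CrpE.
  under eq_cexpect do rewrite !rpE.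
  have alphaE u' m' : alpha m' =
      (complex.Re (form (blkdiag Ch) (signal rho m' (P u')) (signal rho m' (P u'))) + 1)%:C%C.
    rewrite rmorphD rmorph1 /= -(form_self herm) form_signal// /alpha !mxE eqxx.
    congr (_ * _ + _); rewrite summxE; apply: eq_bigr => l _.
    by rewrite mulrC [conjc _ * _]mulrC -sqr_normc P1 expr1n mulr1.
  case: ifPn => [/andP[/eqP <- /eqP <-]|mnuv].
    rewrite (cexpect_quant_self W (source_cov_herm _ Ch_psd))//.
    rewrite form_stack ctr_delta_mul ctr0 mul0mx !mxE !eqxx addr0 ReD /=.
    by rewrite ltr_wpDl.
  have neq : mxvec_index u m != mxvec_index v n.
    apply: contra mnuv => /eqP /(congr1 (@unvec tau M)); rewrite !unvecK => -[-> ->].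
    by rewrite !eqxx.
  have [] := @cexpect_quant_stack M K tau rho Ch _ _ Pr Hm Zp z rho0 Ch_psd W
    (signal rho m (P u)) (delta_mx (mxvec_index u m) 0) 0
    (signal rho n (P v)) (delta_mx (mxvec_index v n) 0) 0.
  + by rewrite ctr_delta_mul ctr0 mul0mx !mxE !eqxx addr0.
  + by rewrite ctr_delta_mul ctr0 mul0mx !mxE !eqxx addr0.
  + by rewrite ctr_delta_mul ctr0 mul0mx !mxE (negbTE neq) addr0.
  set a1 := complex.Re _ + 1; set a2 := complex.Re _ + 1; set g := _ / _ => E1 E2.
  rewrite /pv /pilot_vec !unvecK E1.
  (* [g] contains conj(P_ul) P_vl with C_h untransposed, whereas [zeta] uses P_ul conj(P_vl) with
     the transpose. Hermitian symmetry makes them conjugate, which explains the minus sign before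
     the imaginary term. *)
  have -> : zeta m n u v = conjc g.
    rewrite /zeta (alphaE u m) (alphaE v n) -rmorphM sqrtC_real; last first.
      by rewrite mulr_ge0// addr_ge0.
    rewrite /g conjcM conjc_inv conjc_real mulrAC; congr (_ / _).
    rewrite form_conj// form_signal// summxE; congr (_ * _); apply: eq_bigr => l _.
    by rewrite !mxE [conjc _ * _]mulrC.
  rewrite Re_conjc Im_conjc E2; congr (_ * _).
  by apply: complex_ext; rewrite ?ReD ?ImD ?ReM ?ImM /=; ring.
- move=> m n u; rewrite CrrpE.
  under eq_cexpect do rewrite rpE rE.
  have [] := @cexpect_quant_stack M K tau rho Ch _ _ Pr Hm Zp z rho0 Ch_psd W
    (signal rho m (fun l => conjc (x l 0))) 0 (delta_mx m 0)
    (signal rho n (P u)) (delta_mx (mxvec_index u n) 0) 0.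
  + by rewrite ctr_delta_mul ctr0 mul0mx !mxE !eqxx add0r.
  + by rewrite ctr_delta_mul ctr0 mul0mx !mxE !eqxx addr0.
  (* Data noise and pilot noise occupy different blocks, so their overlap vanishes for all indices
     and no diagonal case arises. *)
  + by rewrite ctr0 mul0mx mulmx0 !mxE addr0.
  set a1 := complex.Re _ + 1; set a2 := complex.Re _ + 1; set g := _ / _ => E1 _.
  rewrite /pv /dv /pilot_vec /data_vec !unvecK E1; congr (_ * _).
  (* The conjugate placed on the data coefficients is undone by the form, so unlike [zeta] this
     ratio matches without conjugation. *)
  have -> : eta m n u = g.
    rewrite /eta.
    have -> : alpha n = a2%:C%C.
      rewrite /a2 rmorphD rmorph1 /= -(form_self herm) form_signal// /alpha !mxE eqxx.
      congr (_ * _ + _); rewrite summxE; apply: eq_bigr => l _.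
      by rewrite mulrC [conjc _ * _]mulrC -sqr_normc P1 expr1n mulr1.
    have -> : beta m = a1%:C%C.
      rewrite /a1 rmorphD rmorph1 /= -(form_self herm) form_signal// /beta !mxE eqxx.
      congr (_ * _ + _); rewrite summxE; apply: eq_bigr => l _.
      by rewrite !mxE conjcK -sqr_normc.
    rewrite -rmorphM sqrtC_real; last by rewrite mulr_ge0// addr_ge0.
    rewrite /g [a2 * a1]mulrC mulrAC; congr (_ / _).
    rewrite form_signal// summxE; congr (_ * _); apply: eq_bigr => l _.
    by rewrite !mxE conjcK.
  by apply: complex_ext; rewrite ?ReD ?ImD ?ReM ?ImM /=; ring.
Qed.
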